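(* Let $\mathcal{F}$ be a non-exceptional collection of rational maps such that every pair of elements of $\mathcal{F}$ shares a common iterate: for all $P,Q\in\mathcal{F}$ there are integers $m,n\ge1$ with $P^m=Q^n$. Then the semigroup $S(\mathcal{F})$ generated by $\mathcal{F}$ under composition is amenable.
   Context: Rational maps are non-constant self-maps of $\overline{\mathbb{C}}$; powers denote iterates. $S(\mathcal{F})$ consists of all finite non-empty compositions of elements of $\mathcal{F}$. A rational map is exceptional if it has degree $1$ or is Möbius conjugate to $z^n$ ($n\in\mathbb{Z}$), to $\pm$ a Chebyshev polynomial, or to a Lattès map. A family is non-exceptional if it contains at least one non-exceptional map. For a semigroup $S$, let $L_\infty(S)$ be the Banach space of bounded complex functions on $S$ with sup norm; a mean is a continuous linear functional $M$ with $M(\phi)\ge0$ for $\phi\ge0$ and $\|M\|=M(\chi_S)=1$. Put $r_s(\phi)(x)=\phi(xs)$, $l_s(\phi)(x)=\phi(sx)$. $S$ is amenable if there is a mean $M$ with $M(r_s\phi)=M(l_s\phi)=M(\phi)$ for all $s\in S$, $\phi\in L_\infty(S)$. *)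

(* Defs.v *)
From HB Require Import structures.
From mathcomp Require Import all_boot all_order all_algebra.
From mathcomp Require Import all_classical all_reals all_analysis.
From mathcomp Require Import complex.

Set Implicit Arguments.
Unset Strict Implicit.
Unset Printing Implicit Defensive.

Import Order.TTheory GRing.Theory Num.Theory.
Import Normc.
Import numFieldNormedType.Exports.

Local Open Scope classical_set_scope.
Local Open Scope ring_scope.
Local Open Scope complex_scope.

Section RationalMaps.
Variable R : realType.

(* [Some z] is the finite point z and [None] the point at infinity. *)
Definition sphere := one_point_compactification R[i]^o.

Implicit Types (p q : {poly R[i]}) (f g mu nu : sphere -> sphere).

Definition fracdeg p q : nat := maxn (size p).-1 (size q).-1.

(* The self-map p/q of the sphere, meaningful for coprime p and q: with
   n = fracdeg p q, its value at infinity is the ratio of the coefficients of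
   degree n, which are not both zero. *)
Definition ratmap p q : sphere -> sphere := fun x =>
  if x is Some z then
    if q.[z] == 0 then None else Some (p.[z] / q.[z])
  else
    let n := fracdeg p q in
    if q`_n == 0 then None else Some (p`_n / q`_n).

Definition has_degree f (d : nat) : Prop :=
  exists p q, [/\ coprimep p q, fracdeg p q = d & f = ratmap p q].

Definition rational_map f : Prop := exists2 d, (0 < d)%N & has_degree f d.

Definition mobius mu : Prop := has_degree mu 1.

Definition mobius_conjugate f g : Prop :=
  exists mu nu, [/\ mobius mu, mobius nu, cancel mu nu, cancel nu mu
                  & f = mu \o g \o nu].

Definition power_map (n : int) : sphere -> sphere :=
  match n with
  | Posz k => ratmap 'X^k 1
  | Negz k => ratmap 1 'X^(k.+1)
  end.

Fixpoint chebyshev_poly (n : nat) : {poly R[i]} :=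
  match n with
  | 0 => 1
  | 1 => 'X
  | (k.+1 as m).+1 => 2%:P * 'X * chebyshev_poly m - chebyshev_poly k
  end.

Definition sphere_inv (x : sphere) : sphere :=
  match x with
  | None => Some 0
  | Some z => if z == 0 then None else Some z^-1
  end.

(* The coordinate z on the sphere; its value at infinity is a dummy. *)
Definition chart (x : sphere) : R[i]^o := odflt 0 x.

(* Derivability in direction 1 over the scalar field R[i] is complex
   differentiability. *)
Definition holo_finite_at (theta : R[i]^o -> sphere) (z : R[i]^o) : Prop :=
  \forall w \near z, theta w <> None /\ derivable (chart \o theta) w 1.

(* Near a pole the coordinate 1/z is used. *)
Definition holomorphic_to_sphere (theta : R[i]^o -> sphere) : Prop :=
  forall z, holo_finite_at theta z \/ holo_finite_at (sphere_inv \o theta) z.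

Definition lattice (w1 w2 : R[i]) : set R[i] :=
  [set z | exists m n : int, z = m%:~R * w1 + n%:~R * w2].

Definition real_independent (w1 w2 : R[i]) : Prop :=
  forall a b : R, a%:C * w1 + b%:C * w2 = 0 -> a = 0 /\ b = 0.

(* g is semiconjugate to the affine self-map z |-> a z + b of the torus
   C / Lambda by a nonconstant holomorphic map from the torus to the sphere;
   maps on the torus are represented by their lifts to C. *)
Definition lattes g : Prop :=
  (exists2 d, (1 < d)%N & has_degree g d) /\
  exists (w1 w2 a b : R[i]) (theta : R[i]^o -> sphere),
    [/\ real_independent w1 w2,
        forall w, lattice w1 w2 w -> lattice w1 w2 (a * w),
        holomorphic_to_sphere theta
          /\ (forall z w, lattice w1 w2 w -> theta (z + w) = theta z),
        exists z z', theta z <> theta z'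
      & forall z, g (theta z) = theta (a * z + b)].

Definition exceptional f : Prop :=
  has_degree f 1 \/
  exists2 g, mobius_conjugate f g &
    [\/ exists n : int, g = power_map n,
        exists n : nat, g = ratmap (chebyshev_poly n) 1
                     \/ g = ratmap (- chebyshev_poly n) 1
      | lattes g].

Definition nonexceptional_family (F : set (sphere -> sphere)) : Prop :=
  exists2 f, F f & ~ exceptional f.

End RationalMaps.

Section GeneratedSemigroup.
Variables (T : choiceType) (F : set (T -> T)).

Inductive composition_of : (T -> T) -> Prop :=
| composition_gen f : F f -> composition_of f
| composition_comp f g :
    composition_of f -> composition_of g -> composition_of (f \o g).

Definition gen_semigroup : Type := set_type [set f | composition_of f].

HB.instance Definition _ := Choice.on gen_semigroup.

Lemma gen_mul_subproof (x y : gen_semigroup) :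
  val x \o val y \in [set f | composition_of f].
Proof.
apply/mem_set; apply: composition_comp.
- exact: (set_mem (valP x)).
- exact: (set_mem (valP y)).
Qed.

Definition gen_mul (x y : gen_semigroup) : gen_semigroup :=
  exist _ (val x \o val y) (gen_mul_subproof x y).

Lemma gen_mulA : associative gen_mul.
Proof. by move=> x y z; apply: val_inj. Qed.

HB.instance Definition _ := isSemigroup.Build gen_semigroup gen_mulA.

End GeneratedSemigroup.

Section Linfty.
Variables (R : realType) (S : Type).

Definition bounded_pred : {pred S -> R[i]^o} :=
  [pred phi | `[< bounded_fun phi >]].

Record Linfty := MkLinfty {
  Linfty_fun :> S -> R[i]^o;
  _ : Linfty_fun \in bounded_pred }.

HB.instance Definition _ := [isSub for Linfty_fun].
HB.instance Definition _ := [Choice of Linfty by <:].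

Lemma normc_ge0 (z : R[i]) : 0 <= normc z.
Proof. by case: z => x y; apply: sqrtr_ge0. Qed.

Lemma bounded_predP (phi : S -> R[i]^o) :
  reflect (exists M : R, forall s, normc (phi s) <= M) (phi \in bounded_pred).
Proof.
apply: (iffP (asboolP _)).
- move=> [M [Mreal hM]].
  have hM1 : M < M + 1 by rewrite ltrDl ltr01.
  exists (complex.Re (M + 1)) => s.
  have h : `|phi s : R[i]| <= M + 1 by exact: hM _ hM1 s I.
  by move: h; rewrite lecE => /andP[].
- move=> [M hM]; exists M%:C; split; first by rewrite complex_real.
  move=> x Mx s _ /=; apply: le_trans (ltW Mx).
  by have := hM s; rewrite -lecR.
Qed.

Lemma bounded_submod_closed : submod_closed bounded_pred.
Proof.
split.
- by apply/bounded_predP; exists 0 => s; rewrite normc0.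
- move=> a f g /bounded_predP[M hM] /bounded_predP[N hN].
  apply/bounded_predP; exists (normc a * M + N) => s.
  apply: le_trans (le_normcD (a * f s) (g s)) _; apply: lerD => //.
  by rewrite normcM ler_wpM2l ?normc_ge0.
Qed.

HB.instance Definition _ :=
  GRing.isSubmodClosed.Build R[i] (S -> R[i]^o) bounded_pred
    bounded_submod_closed.
HB.instance Definition _ := [SubChoice_isSubLmodule of Linfty by <:].

(* The value is 0 when S is empty. *)
Definition supnorm (phi : Linfty) : R := sup (range (fun s => normc (phi s))).

Lemma supnorm_empty (phi : Linfty) : ~ inhabited S -> supnorm phi = 0.
Proof.
move=> S0; rewrite -[RHS](@sup0 R); congr sup.
by rewrite -subset0 => x [t] _ _; apply: S0.
Qed.

Lemma normc_le_supnorm (phi : Linfty) s : normc (phi s) <= supnorm phi.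
Proof.
apply: ub_le_sup; last by exists s.
have [M hM] := bounded_predP _ (valP phi).
by exists M => _ [t _ <-].
Qed.

Lemma supnorm_le (phi : Linfty) (M : R) :
  0 <= M -> (forall s, normc (phi s) <= M) -> supnorm phi <= M.
Proof.
move=> M0 hM; have [[s]|S0] := pselect (inhabited S).
- by apply: ge_sup; [exists (normc (phi s)), s | move=> _ [t _ <-]].
- by rewrite supnorm_empty.
Qed.

Lemma supnorm_ge0 (phi : Linfty) : 0 <= supnorm phi.
Proof.
have [[s]|S0] := pselect (inhabited S).
- by apply: le_trans (normc_le_supnorm phi s); apply: normc_ge0.
- by rewrite supnorm_empty.
Qed.

Lemma supnormD (phi psi : Linfty) :
  (supnorm (phi + psi))%:C <= (supnorm phi)%:C + (supnorm psi)%:C.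
Proof.
rewrite -rmorphD lecR; apply: supnorm_le => [|s].
  by rewrite addr_ge0 ?supnorm_ge0.
apply: le_trans (le_normcD (phi s) (psi s)) _.
by apply: lerD; apply: normc_le_supnorm.
Qed.

Lemma supnormZ (l : R[i]) (phi : Linfty) :
  (supnorm (l *: phi))%:C = `|l| * (supnorm phi)%:C.
Proof.
have le_supnormZ (k : R[i]) psi : supnorm (k *: psi) <= normc k * supnorm psi.
  apply: supnorm_le => [|s]; first by rewrite mulr_ge0 ?supnorm_ge0 ?normc_ge0.
  rewrite (_ : (k *: psi) s = k * psi s) // normcM.
  by rewrite ler_wpM2l ?normc_ge0 ?normc_le_supnorm.
rewrite -[`|l|]/((normc l)%:C) -rmorphM; congr (_%:C).
apply/eqP; rewrite eq_le le_supnormZ /=.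
have [->|l0] := eqVneq l 0; first by rewrite normc0 mul0r supnorm_ge0.
have nl : 0 < normc l.
  by rewrite lt0r normc_ge0 andbT; apply: contra_neq l0 => /eq0_normc.
rewrite -ler_pdivlMl // -normcV.
by rewrite -{1}[phi](scalerK l0) le_supnormZ.
Qed.

Lemma supnorm_eq0 (phi : Linfty) : (supnorm phi)%:C = 0 -> phi = 0.
Proof.
case=> phi0; apply: val_inj; apply/funext => s.
by apply: eq0_normc; apply/eqP; rewrite eq_le normc_ge0 -phi0 normc_le_supnorm.
Qed.

HB.instance Definition _ :=
  Lmodule_isNormed.Build R[i] Linfty supnormD supnormZ supnorm_eq0.

Lemma Linfty_cst_subproof : cst (1 : R[i]^o) \in bounded_pred.
Proof. by apply/bounded_predP; exists 1 => s; rewrite normc1. Qed.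

Definition Linfty1 : Linfty := MkLinfty Linfty_cst_subproof.

Lemma Linfty_comp_subproof (phi : Linfty) (u : S -> S) :
  phi \o u \in bounded_pred.
Proof.
apply/bounded_predP; exists (supnorm phi) => s; exact: normc_le_supnorm.
Qed.

Definition Linfty_comp (u : S -> S) (phi : Linfty) : Linfty :=
  MkLinfty (Linfty_comp_subproof phi u).

End Linfty.

Definition opnorm (R : realType) (V : normedModType R[i])
    (M : V -> R[i]^o) : R :=
  sup [set normc (M v) | v in [set v | `|v| <= 1]].

Section Amenability.
Variables (R : realType) (S : semigroupType).

Definition rtrans (s : S) : Linfty R S -> Linfty R S :=
  Linfty_comp (fun x => (x * s)%g).

Definition ltrans (s : S) : Linfty R S -> Linfty R S :=
  Linfty_comp (fun x => (s * x)%g).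

(* In R[i], 0 <= z means that z is a nonnegative real number. *)
Definition mean (M : {linear Linfty R S -> R[i]^o}) : Prop :=
  [/\ continuous M,
      forall phi : Linfty R S, (forall s, 0 <= phi s) -> 0 <= M phi,
      opnorm M = 1
    & M (Linfty1 R S) = 1].

Definition amenable : Prop :=
  exists2 M : {linear Linfty R S -> R[i]^o}, mean M &
    forall (s : S) (phi : Linfty R S),
      M (rtrans s phi) = M phi /\ M (ltrans s phi) = M phi.

End Amenability.

(* Main.v *)
Require Import Defs.
From HB Require Import structures.
From mathcomp Require Import all_boot all_order all_algebra.
From mathcomp Require Import all_classical all_reals all_analysis.
From mathcomp Require Import complex.
From mathcomp Require Import ring lra zify.

(**
Finitely many elements of F have a common iterate h, which commutes with every
word in them; as rational maps are onto, the subsemigroup they generate is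
cancellative. It therefore suffices to show that the number of maps given by
words of length at most n grows polynomially in n: some of these finite sets are
then almost invariant under left and right translations, and an invariant mean
is an ultrafilter limit of the averages over such sets.

To count, fix a fixed point p of h and expand words at p. Let h ~ a t^k there.
A map A commuting with h is determined by A(p) and
- its leading term c t^l, if k > 1 or if a is not a root of unity;
- its derivative c and its coefficient of order m, if (after passing to an
  iterate) h = t + d t^m + ... with d <> 0.
In each case all but finitely much of this information is a sum or a product,
in a commutative monoid, of contributions of the transitions (letter, state)
made while the word is applied to p. So a word is determined, up to finitely
many choices, by the multiset of its transitions.

Since a non-exceptional map has degree at least 2, h is not injective, so no
iterate of h is the identity; this is what makes d <> 0 possible above.
*)

Set Implicit Arguments.
Unset Strict Implicit.
Unset Printing Implicit Defensive.

Import Order.TTheory GRing.Theory Num.Theory.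

(** * Words and polynomial growth *)

Definition compose_word (T : Type) (w : seq (T -> T)) : T -> T :=
  foldr (fun f g => f \o g) idfun w.

(** Bernoulli's inequality for [(1 + 1/M)^k], with denominators cleared. *)
Lemma bernoulli_expn (M k : nat) : (M ^ k * (M + k) <= M.+1 ^ k * M)%N.
Proof.
elim: k => [|k IH]; first by rewrite addn0.
rewrite !expnS; apply: (@leq_trans (M.+1 * (M ^ k * (M + k)))).
  by move: (M ^ k)%N => a; nia.
by rewrite -mulnA leq_mul2l IH orbT.
Qed.

Lemma exp_beats_poly (M c e : nat) :
  exists n, (M.+1 ^ n * (c * n.+2 ^ e) < M.+2 ^ n)%N.
Proof.
(* Bernoulli gives [((M+2)/(M+1))^((M+1)m) >= m+1]. Raised to the power [e+1] this exceeds
   [m (m+1)^e], and [m] is chosen so that [c (n+2)^e <= m (m+1)^e] for [n = (M+1) m (e+1)]. *)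
pose m := (c * (M.+1 * e.+1 + 2) ^ e)%N.
exists (M.+1 * m * e.+1)%N.
have step : (M.+1 ^ (M.+1 * m) * m.+1 <= M.+2 ^ (M.+1 * m))%N.
  have := bernoulli_expn M.+1 (M.+1 * m).
  by rewrite -mulnS mulnA [(_ * m.+1)%N]mulnC mulnA leq_pmul2r // mulnC.
have {}step : (M.+1 ^ (M.+1 * m * e.+1) * m.+1 ^ e.+1 <= M.+2 ^ (M.+1 * m * e.+1))%N.
  by rewrite !(expnM _ (M.+1 * m)) -expnMn leq_exp2r.
apply: leq_trans step; rewrite ltn_pmul2l ?expn_gt0 //.
apply: (@leq_ltn_trans (m * m.+1 ^ e)); last by rewrite expnS ltn_pmul2r ?expn_gt0.
have -> : (m * m.+1 ^ e = c * ((M.+1 * e.+1 + 2) * m.+1) ^ e)%N.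
  by rewrite expnMn mulnA.
rewrite leq_mul2l; apply/orP; right.
case: (e) => // e'; rewrite leq_exp2r //; nia.
Qed.

(** If every ratio exceeded [1 + 1/(N+1)], [b] would grow exponentially. Applied to the sizes of
    balls of words, this produces almost invariant sets. *)
Lemma growth_ratio (b : nat -> nat) (c e N : nat) :
  (forall n, (0 < b n.+1)%N) -> (forall n, (b n <= c * n.+1 ^ e)%N) ->
  exists n, (b n.+2 * N.+1 <= b n.+1 * N.+2)%N.
Proof.
move=> b0 bc; apply: contrapT => /forallNP bN.
have {}bN n : (b n.+1 * N.+2 < b n.+2 * N.+1)%N.
  by rewrite ltnNge; apply/negP; exact: bN.
have lb n : (N.+2 ^ n <= b n.+1 * N.+1 ^ n)%N.
  elim: n => [|n IH]; first by rewrite muln1.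
  rewrite !expnSr; apply: (@leq_trans (b n.+1 * N.+1 ^ n * N.+2)).
    by rewrite leq_mul2r IH orbT.
  by rewrite mulnAC [leqRHS]mulnCA [leqRHS]mulnC leq_mul2r (ltnW (bN n)) orbT.
have [n] := exp_beats_poly N c e; rewrite ltnNge => /negP; apply.
by apply: leq_trans (lb n) _; rewrite mulnC leq_mul2l bc orbT.
Qed.

Fixpoint words (T : Type) (Ks : seq T) (n : nat) : seq (seq T) :=
  if n is m.+1 then [seq x :: w | x <- Ks, w <- [::] :: words Ks m] else [::].

Lemma mem_words (T : eqType) (Ks : seq T) n w :
  (w \in words Ks n) = [&& all (mem Ks) w, 0 < size w & size w <= n]%N.
Proof.
elim: n w => [|n IH] [|x w] //; first by rewrite /= !andbF.
  by apply/negbTE/negP => /allpairsP[[y v] []].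
apply/allpairsP/and3P => [[[y v] [yK + [-> ->]]]|[]].
  by rewrite inE /= => /orP[/eqP->|]; rewrite yK //= IH => /and3P[-> _ ?]; split.
rewrite /= => /andP[xK wK] _ wn.
exists (x, w); split=> //; rewrite inE IH wK /=.
by case: (w) wn.
Qed.

Lemma compose_word_rcons (T : Type) (w : seq (T -> T)) f :
  compose_word (rcons w f) = compose_word w \o f.
Proof. by elim: w => //= g w ->. Qed.

Lemma common_iterate_seq (T : choiceType) (F : set (T -> T)) (f : T -> T)
    (Ks : seq (T -> T)) :
  (forall P, F P -> exists m n,
     (1 <= m)%N /\ (1 <= n)%N /\ iter m P = iter n f) ->
  (forall P, P \in Ks -> F P) ->
  exists n, forall P, P \in Ks -> exists m, iter m.+1 P = iter n.+1 f.
Proof.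
have iter_mult (g h : T -> T) k m n : iter m g = iter n h ->
    iter (k * m) g = iter (k * n) h.
  by move=> gh; apply/funext => x; rewrite !iterM gh.
move=> FP; elim: Ks => [|P Ks IH] KF; first by exists 0%N.
have [|n nP] := IH; first by move=> Q QK; apply: KF; rewrite inE QK orbT.
have [m [k [m0 [k0 mk]]]] := FP P (KF P (mem_head _ _)).
case: m m0 mk => // m _; case: k k0 => // k _ mk.
exists (n.+1 * k.+1).-1 => Q; rewrite inE prednK ?muln_gt0 // => /orP[/eqP->|/nP[j jn]].
  by exists (n.+1 * m.+1).-1; rewrite prednK ?muln_gt0 //; exact: iter_mult.
exists (k.+1 * j.+1).-1; rewrite prednK ?muln_gt0 // [(n.+1 * _)%N]mulnC.
exact: iter_mult.
Qed.

Section WordCounting.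
Variables (T E U : eqType) (st : seq T -> U) (ev : seq T -> E).

(** [compose_word] applies the last letter first, so [st v] is the state on which the letter [x]
    acts. *)
Fixpoint transitions (w : seq T) : seq (T * U) :=
  if w is x :: v then (x, st v) :: transitions v else [::].

Lemma size_transitions w : size (transitions w) = size w.
Proof. by elim: w => //= x w ->. Qed.

Definition poly_growth (Ks : seq T) : Prop := exists c e : nat,
  forall (n : nat) (s : seq E), uniq s ->
    (forall x, x \in s ->
       exists w, [/\ all (mem Ks) w, (size w <= n)%N & ev w = x]) ->
    (size s <= c * n.+1 ^ e)%N.

(* The number of multisets of at most n transitions is polynomial in n. *)
Lemma poly_growth_transitions (Ks : seq T) (L : seq U) :
  (forall w, all (mem Ks) w -> st w \in L) ->
  (forall w w', all (mem Ks) w -> all (mem Ks) w' -> st w = st w' ->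
     perm_eq (transitions w) (transitions w') -> ev w = ev w') ->
  poly_growth Ks.
Proof.
move=> stL evE; exists (size L).+1, (size Ks * size L)%N => n s us sP.
have [wd wdP] : exists wd : E -> seq T, forall x, x \in s ->
    [/\ all (mem Ks) (wd x), (size (wd x) <= n)%N & ev (wd x) = x].
  have /choice[wd wdP] : forall x, exists w, x \in s ->
      [/\ all (mem Ks) w, (size w <= n)%N & ev w = x].
    by move=> x; have [/sP[w ?]|_] := boolP (x \in s); [exists w | exists [::]].
  by exists wd.
pose lt (i : 'I_(size Ks)) (j : 'I_(size L)) : T * U :=
  (tnth (in_tuple Ks) i, tnth (in_tuple L) j).
(* The key records the final state and the multiplicity, at most [n], of each transition; there are
   [(size L).+1 * n.+1 ^ (size Ks * size L)] keys. *)
pose key x : 'I_(size L).+1 * {ffun 'I_(size Ks) * 'I_(size L) -> 'I_n.+1} :=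
  (inord (index (st (wd x)) L),
   [ffun ij => inord (count_mem (lt ij.1 ij.2) (transitions (wd x)))]).
have trKL w : all (mem Ks) w -> forall y, y \in transitions w ->
    exists i j, y = lt i j.
  elim: w => //= x w IH /andP[xK wK] y; rewrite inE => /orP[/eqP->|]; last exact: IH.
  have xi : (index x Ks < size Ks)%N by rewrite index_mem.
  have wj : (index (st w) L < size L)%N by rewrite index_mem stL.
  exists (Ordinal xi), (Ordinal wj); rewrite /lt !(tnth_nth x) !(tnth_nth (st w)) /=.
  by rewrite !nth_index // stL.
have key_inj : {in s &, injective key}.
  move=> x y xs ys [/(congr1 val) + /ffunP kE].
  have [xK xn xE] := wdP x xs; have [yK yn yE] := wdP y ys.
  rewrite /= !inordK ?ltnS ?index_size // => iE.
  rewrite -xE -yE; apply: evE => //.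
    have xi : (index (st (wd x)) L < size L)%N by rewrite index_mem stL.
    rewrite -(nth_index (st (wd x)) (stL _ xK)) iE.
    by rewrite nth_index // stL.
  have cE i j : count_mem (lt i j) (transitions (wd x)) =
                count_mem (lt i j) (transitions (wd y)).
    have := kE (i, j); rewrite !ffunE => /(congr1 val).
    by rewrite /= !inordK // ltnS; apply: leq_trans (count_size _ _) _;
      rewrite size_transitions.
  apply/allP => y'; rewrite mem_cat => /orP[] /trKL;
    by [move=> /(_ xK)[i [j ->]]; apply/eqP | move=> /(_ yK)[i [j ->]]; apply/eqP].
have -> : size s = size (map key s) by rewrite size_map.
have := max_card (mem (map key s)).
rewrite (card_uniqP _); last by rewrite map_inj_in_uniq.
by rewrite card_prod card_ffun card_prod !card_ord.
Qed.

End WordCounting.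

(** * Germs of rational functions at 0 *)

Local Open Scope ring_scope.

Section Germs.
Variable K : numFieldType.
Implicit Types (P Q : K -> Prop) (u v w g : K -> K) (N D : {poly K}).

Lemma poly_fun0 N : (forall t, N.[t] = 0) -> N = 0.
Proof.
move=> N0; apply/eqP; apply: contraT => nzN.
have := @max_poly_roots _ N [seq i%:R | i <- iota 0 (size N)] nzN.
rewrite size_map size_iota ltnn; apply.
  by apply/allP => t _; rewrite /root N0.
by rewrite map_inj_uniq ?iota_uniq // => i j /eqP; rewrite eqr_nat => /eqP.
Qed.

(* Holds near [0], and at [0] itself: the exceptional points are the zeros of a
   polynomial not vanishing at [0]. *)
Definition ae P : Prop :=
  exists2 D, D.[0] != 0 & forall t, D.[t] != 0 -> P t.

Lemma aeT P : (forall t, P t) -> ae P.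
Proof. by move=> PT; exists 1 => [|t _]; rewrite ?hornerC ?oner_eq0. Qed.

Lemma ae_imp P Q : ae P -> (forall t, P t -> Q t) -> ae Q.
Proof. by move=> [D D0 PD] PQ; exists D => // t /PD/PQ. Qed.

Lemma aeI P Q : ae P -> ae Q -> ae (fun t => P t /\ Q t).
Proof.
move=> [D D0 PD] [E E0 QE]; exists (D * E).
  by rewrite hornerM mulf_neq0.
by move=> t; rewrite hornerM mulf_eq0 negb_or => /andP[/PD ? /QE ?].
Qed.

Lemma ae_at0 P : ae P -> P 0.
Proof. by case=> D D0; apply. Qed.

Lemma ae_inf P : ae P -> exists2 D, D != 0 & forall t, D.[t] != 0 -> P t.
Proof.
move=> [D D0 PD]; exists D => //.
by apply: contraNneq D0 => ->; rewrite horner0.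
Qed.

(** Nothing is required of [u] at the zeros of [D], so dummy values of the coordinates at poles do
    no harm. *)
Definition germ u : Prop :=
  exists N D, D.[0] != 0 /\ forall t, D.[t] != 0 -> u t = N.[t] / D.[t].

Lemma germ_ext u v : germ u -> ae (fun t => v t = u t) -> germ v.
Proof.
move=> [N [D [D0 uE]]] [E E0 uv]; exists (N * E), (D * E).
split=> [|t]; first by rewrite hornerM mulf_neq0.
rewrite !hornerM mulf_eq0 negb_or => /andP[Dt Et].
by rewrite uv // uE //; field; rewrite Dt Et.
Qed.

Lemma germ_poly N : germ (fun t => N.[t]).
Proof.
exists N, 1; split=> [|t _]; rewrite hornerC ?oner_eq0 //.
by rewrite divr1.
Qed.

Lemma germ_cst a : germ (fun _ => a).
Proof. by apply: (germ_ext (germ_poly a%:P)); apply: aeT => t; rewrite hornerC. Qed.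

Lemma germ_id : germ id.
Proof. by apply: (germ_ext (germ_poly 'X)); apply: aeT => t; rewrite hornerX. Qed.

Lemma germD u v : germ u -> germ v -> germ (fun t => u t + v t).
Proof.
move=> [N [D [D0 uE]]] [N' [E [E0 vE]]]; exists (N * E + N' * D), (D * E).
split=> [|t]; first by rewrite hornerM mulf_neq0.
rewrite !hornerE mulf_eq0 negb_or => /andP[Dt Et].
by rewrite uE // vE //; field; rewrite Dt Et.
Qed.

Lemma germM u v : germ u -> germ v -> germ (fun t => u t * v t).
Proof.
move=> [N [D [D0 uE]]] [N' [E [E0 vE]]]; exists (N * N'), (D * E).
split=> [|t]; first by rewrite hornerM mulf_neq0.
rewrite !hornerE mulf_eq0 negb_or => /andP[Dt Et].
by rewrite uE // vE //; field; rewrite Dt Et.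
Qed.

Lemma germB u v : germ u -> germ v -> germ (fun t => u t - v t).
Proof.
move=> gu gv; apply: (germ_ext (germD gu (germM (germ_cst (-1)) gv))).
by apply: aeT => t; rewrite mulN1r.
Qed.

Lemma germX u n : germ u -> germ (fun t => u t ^+ n).
Proof.
move=> gu; elim: n => [|n IH]; first exact: germ_cst.
by apply: (germ_ext (germM gu IH)); apply: aeT => t; rewrite exprS.
Qed.

Lemma germ_sum (I : Type) (r : seq I) (F : I -> K -> K) :
  (forall i, germ (F i)) -> germ (fun t => \sum_(i <- r) F i t).
Proof.
move=> gF; elim: r => [|i r IH].
  by apply: (germ_ext (germ_cst 0)); apply: aeT => t; rewrite big_nil.
by apply: (germ_ext (germD (gF i) IH)); apply: aeT => t; rewrite big_cons.
Qed.

Lemma germ_neq0 u : germ u -> u 0 != 0 -> ae (fun t => u t != 0).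
Proof.
move=> [N [D [D0 uE]]]; rewrite uE // mulf_eq0 negb_or => /andP[N0 _].
exists (N * D) => [|t]; first by rewrite hornerM mulf_neq0.
rewrite hornerM mulf_eq0 negb_or => /andP[Nt Dt].
by rewrite uE // mulf_neq0 ?invr_neq0.
Qed.

Lemma germV u : germ u -> u 0 != 0 -> germ (fun t => (u t)^-1).
Proof.
move=> [N [D [D0 uE]]]; rewrite uE // mulf_eq0 negb_or => /andP[N0 _].
exists (D * D), (N * D); split=> [|t]; first by rewrite hornerM mulf_neq0.
rewrite !hornerM mulf_eq0 negb_or => /andP[Nt Dt].
by rewrite uE //; field; rewrite Nt Dt.
Qed.

Lemma germ_horner N u : germ u -> germ (fun t => N.[u t]).
Proof.
move=> gu; elim/poly_ind: N => [|N c IH].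
  by apply: (germ_ext (germ_cst 0)); apply: aeT => t; rewrite horner0.
apply: (germ_ext (germD (germM IH gu) (germ_cst c))).
by apply: aeT => t; rewrite !hornerE.
Qed.

Lemma ae_comp P v : ae P -> germ v -> v 0 = 0 -> ae (fun t => P (v t)).
Proof.
move=> [D D0 PD] gv v0.
have := germ_neq0 (germ_horner D gv); rewrite v0 => /(_ D0) aeD.
by apply: ae_imp aeD _ => t /PD.
Qed.

Lemma germ_comp u v : germ u -> germ v -> v 0 = 0 -> germ (fun t => u (v t)).
Proof.
move=> [N [D [D0 uE]]] gv v0.
have gD : germ (fun t => (D.[v t])^-1).
  by apply: germV; [exact: germ_horner | rewrite v0].
apply: (germ_ext (germM (germ_horner N gv) gD)).
by apply: (@ae_comp (fun s => u s = N.[s] * (D.[s])^-1) v _ gv v0); exists D.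
Qed.

Lemma germ_cancel m u v : germ u -> germ v ->
  ae (fun t => t ^+ m * u t = t ^+ m * v t) -> u 0 = v 0.
Proof.
move=> [N [D [D0 uE]]] [N' [D' [D'0 vE]]] [E E0 uv].
have nzE0 (Q : {poly K}) : Q.[0] != 0 -> Q != 0.
  by apply: contraNneq => ->; rewrite horner0.
(* Cross-multiplication gives an identity off finitely many points; the factor [E * D * D'] makes it
   hold everywhere and is then cancelled as a nonzero polynomial. *)
have : 'X^m * (N * D' - N' * D) * (E * D * D') = 0.
  apply: poly_fun0 => t; rewrite !hornerM hornerXn hornerD hornerN !hornerM.
  have [Et|Et] := eqVneq E.[t] 0; first by rewrite Et; ring.
  have [Dt|Dt] := eqVneq D.[t] 0; first by rewrite Dt; ring.
  have [Dt'|Dt'] := eqVneq D'.[t] 0; first by rewrite Dt'; ring.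
  have := uv t Et; rewrite uE // vE // => e.
  transitivity ((t ^+ m * (N.[t] / D.[t]) - t ^+ m * (N'.[t] / D'.[t]))
                 * (E.[t] * D.[t] ^+ 2 * D'.[t] ^+ 2)).
    by field; rewrite Dt Dt'.
  by rewrite e subrr mul0r.
move/eqP; rewrite !mulf_eq0 expf_eq0 polyX_eq0 andbF /=.
rewrite (negPf (nzE0 _ E0)) (negPf (nzE0 _ D0)) (negPf (nzE0 _ D'0)) !orbF.
rewrite subr_eq0 => /eqP /(congr1 (horner^~ 0)); rewrite !hornerM => e.
by rewrite uE // vE //; apply/eqP; rewrite eqr_div // e.
Qed.

(** Divided differences: [u - v] divides [M(u) - M(v)] for every polynomial [M], by induction on
    [M], and the quotient rule passes this on to [g = N / D]. *)
Lemma germ_diff g u v : germ g -> germ u -> germ v -> u 0 = 0 -> v 0 = 0 ->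
  exists2 k, germ k & ae (fun t => g (u t) - g (v t) = (u t - v t) * k t).
Proof.
move=> [N [D [D0 gE]]] gu gv u0 v0.
have polyk (M : {poly K}) : exists2 k, germ k &
    forall t, M.[u t] - M.[v t] = (u t - v t) * k t.
  elim/poly_ind: M => [|M c [k gk IH]].
    by exists (fun _ => 0) => [|t]; [exact: germ_cst | rewrite !horner0 mulr0 subr0].
  exists (fun t => k t * u t + M.[v t]).
    by apply: germD; [exact: germM | exact: germ_horner].
  move=> t; rewrite !hornerE mulrDr mulrA -IH; ring.
have [kN gkN kNE] := polyk N; have [kD gkD kDE] := polyk D.
have nu := germ_neq0 (germ_horner D gu); rewrite u0 in nu.
have nv := germ_neq0 (germ_horner D gv); rewrite v0 in nv.
exists (fun t => (kN t * D.[v t] - N.[v t] * kD t) * ((D.[u t])^-1 * (D.[v t])^-1)).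
  apply: germM.
    by apply: germB; apply: germM => //; exact: germ_horner.
  by apply: germM; apply: germV; rewrite ?u0 ?v0 //; exact: germ_horner.
apply: ae_imp (aeI (nu D0) (nv D0)) _ => t [Du Dv].
rewrite !gE // mulrA mulrBr !mulrA -kNE.
transitivity ((((N.[u t] - N.[v t]) * D.[v t] - N.[v t] * (D.[u t] - D.[v t]))
                * (D.[u t])^-1 * (D.[v t])^-1)); first by field; rewrite Du Dv.
by rewrite kDE; ring.
Qed.

(* [lead u m e] states that [u t = e t^m + O(t^(m+1))]; [e] may be [0]. *)
Definition lead u (m : nat) (e : K) : Prop :=
  exists w, [/\ germ w, w 0 = e & ae (fun t => u t = t ^+ m * w t)].

Lemma lead_germ u m e : lead u m e -> germ u.
Proof.
move=> [w [gw _ uE]].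
by apply: germ_ext uE; apply: germM gw; apply: germX germ_id.
Qed.

Lemma lead_ext u v m e : lead u m e -> ae (fun t => v t = u t) -> lead v m e.
Proof.
move=> [w [gw w0 uE]] vu; exists w; split => //.
by apply: ae_imp (aeI uE vu) _ => t [<- ->].
Qed.

Lemma lead_at0 u m e : (0 < m)%N -> lead u m e -> u 0 = 0.
Proof. by case: m => // m _ [w [_ _ /ae_at0 ->]]; rewrite expr0n mul0r. Qed.

Lemma lead_pos u m e : u 0 = 0 -> e != 0 -> lead u m e -> (0 < m)%N.
Proof.
move=> u0 e0 [w [_ w0 /ae_at0]]; case: m => //.
by rewrite u0 expr0 mul1r w0 => e00; rewrite -e00 eqxx in e0.
Qed.

Lemma lead_id : lead id 1 1.
Proof.
exists (fun _ => 1); split=> //; first exact: germ_cst.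
by apply: aeT => t; rewrite mulr1.
Qed.

Lemma leadB u v m e f : lead u m e -> lead v m f ->
  lead (fun t => u t - v t) m (e - f).
Proof.
move=> [w [gw <- uE]] [w' [gw' <- vE]]; exists (fun t => w t - w' t); split=> //.
  exact: germB.
by apply: ae_imp (aeI uE vE) _ => t [-> ->]; rewrite mulrBr.
Qed.

Lemma leadD u v m e f : lead u m e -> lead v m f ->
  lead (fun t => u t + v t) m (e + f).
Proof.
move=> [w [gw <- uE]] [w' [gw' <- vE]]; exists (fun t => w t + w' t); split=> //.
  exact: germD.
by apply: ae_imp (aeI uE vE) _ => t [-> ->]; rewrite mulrDr.
Qed.

Lemma lead_inj u m e f : lead u m e -> lead u m f -> e = f.
Proof.
move=> [w [gw <- uE]] [w' [gw' <- vE]]; apply: (germ_cancel (m := m)) => //.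
by apply: ae_imp (aeI uE vE) _ => t [<- <-].
Qed.

Lemma lead_gt u l m e : lead u l 0 -> lead u m e -> e != 0 -> (l < m)%N.
Proof.
move=> [w [gw w0 uE]] [w' [gw' w'0 vE]] nze; rewrite ltnNge.
apply/negP => lm; move: nze; rewrite -w'0.
rewrite (@germ_cancel m w' (fun t => t ^+ (l - m) * w t)) //.
- by rewrite w0 mulr0 eqxx.
- by apply: germM gw; apply: germX germ_id.
- apply: ae_imp (aeI uE vE) _ => t [ut <-].
  by rewrite ut mulrA -exprD subnKC.
Qed.

Lemma lead_low u l m e : (l < m)%N -> lead u m e -> lead u l 0.
Proof.
move=> lm [w [gw w0 uE]]; exists (fun t => t ^+ (m - l) * w t); split.
- by apply: germM gw; apply: germX germ_id.
- by rewrite expr0n subn_eq0 leqNgt lm mul0r.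
- by apply: ae_imp uE _ => t ->; rewrite mulrA -exprD subnKC // ltnW.
Qed.

Lemma lead_uniq u m n e f : lead u m e -> lead u n f -> e != 0 -> f != 0 ->
  m = n /\ e = f.
Proof.
move=> um un e0 f0; case: (ltngtP m n) => [mn|nm|mn].
- by have := lead_inj um (lead_low mn un) => e00; rewrite e00 eqxx in e0.
- by have := lead_inj un (lead_low nm um) => f00; rewrite f00 eqxx in f0.
- by split=> //; rewrite mn in um; exact: lead_inj um un.
Qed.

Lemma germ_lead u : germ u ->
  ae (fun t => u t = 0) \/ exists m e, e != 0 /\ lead u m e.
Proof.
move=> [N [D [D0 uE]]]; have [N0|nzN] := eqVneq N 0.
  by left; exists D => // t /uE ->; rewrite N0 horner0 mul0r.
right; have [m [M /implyP/(_ nzN) M0 NE]] := multiplicity_XsubC N 0.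
exists m, (M.[0] / D.[0]).
split; first by rewrite mulf_neq0 ?invr_neq0.
exists (fun t => M.[t] / D.[t]); split=> //; first by exists M, D.
exists D => // t /uE ->; rewrite NE subr0 hornerM hornerXn; ring.
Qed.

Lemma lead_comp u v m l e c : (0 < l)%N -> lead u m e -> lead v l c ->
  lead (fun t => u (v t)) (l * m) (e * c ^+ m).
Proof.
move=> l0 [w [gw <- uE]] lv; have v0 := lead_at0 l0 lv.
have gv := lead_germ lv; case: lv => w' [gw' <- vE].
exists (fun t => w (v t) * w' t ^+ m); split.
- by apply: germM; [exact: germ_comp | exact: germX].
- by rewrite v0.
- apply: ae_imp (aeI (ae_comp uE gv v0) vE) _ => t [-> vt].
  by rewrite {1}vt exprMn -exprM; ring.
Qed.

(** A mean value principle: to leading order, [g u - g v] is [u - v] times the derivative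
    [j b s^(j-1)] of [b s^j] at [s = c t^l]. *)
Lemma lead_sub g u v j l m b c e : (0 < j)%N -> (0 < l)%N ->
  lead g j b -> lead u l c -> lead v l c -> lead (fun t => u t - v t) m e ->
  lead (fun t => g (u t) - g (v t)) (m + l * j.-1) (e * (b * c ^+ j.-1 *+ j)).
Proof.
move=> j0 l0 [w [gw w0 gE]] lu lv [d [gd d0 dE]].
have u0 := lead_at0 l0 lu; have v0 := lead_at0 l0 lv.
have gu := lead_germ lu; have gv := lead_germ lv.
case: lu => u1 [gu1 u10 uE]; case: lv => v1 [gv1 v10 vE].
have [k gk kE] := germ_diff gw gu gv u0 v0.
pose s t := \sum_(i < j) u1 t ^+ (j.-1 - i) * v1 t ^+ i.
have gs : germ s.
  by apply: germ_sum => i; apply: germM; exact: germX.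
exists (fun t => d t * (s t * w (u t) + t ^+ l * v1 t ^+ j * k t)); split.
- apply: germM gd _; apply: germD; first by apply: germM gs _; exact: germ_comp.
  by apply: germM gk; apply: germM; apply: germX => //; exact: germ_id.
- rewrite d0 u0 w0 expr0n eqn0Ngt l0 !mul0r addr0; congr (_ * _).
  rewrite /s u10 v10 (eq_bigr (fun=> c ^+ j.-1)); last first.
    by move=> i _; rewrite -exprD subnK //; case: (j) i => [[]|n] //= i; rewrite -ltnS.
  by rewrite sumr_const card_ord mulrC mulrnAr.
- apply: ae_imp (aeI (aeI (ae_comp gE gu u0) (ae_comp gE gv v0))
                  (aeI dE (aeI kE (aeI uE vE)))) _.
  move=> t [[-> ->] [dt [kt [ut vt]]]].
  (* The first summand carries the leading term; the second has order at least [m + l * j]. *)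
  transitivity ((u t ^+ j - v t ^+ j) * w (u t)
                + v t ^+ j * (w (u t) - w (v t))); first by ring.
  have -> : u t ^+ j - v t ^+ j = (u t - v t) * (t ^+ (l * j.-1) * s t).
    rewrite subrXX; congr (_ * _); rewrite /s big_distrr /=.
    apply: eq_bigr => i _; rewrite ut vt !exprMn -!exprM.
    rewrite mulrACA -exprD -mulnDr subnK //.
    by case: (j) i => [[]|n] //= i; rewrite -ltnS.
  rewrite kt dt vt exprMn -exprM exprD.
  have -> : (l * j = l * j.-1 + l)%N by rewrite -mulnSr prednK.
  by rewrite exprD; ring.
Qed.

End Germs.

(** * Rational maps of the sphere and their local expansions *)

Section ProjectiveMaps.
Variable R : realType.
Local Notation C := R[i].
Local Notation S := (sphere R).
Implicit Types (f g h A B : S -> S) (a b : S) (p q : {poly C}).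

(** The point with homogeneous coordinates [[x : y]]; the value at [(0, 0)] is junk. *)
Definition pt (x y : C) : S := if y == 0 then None else Some (x / y).

Lemma pt_eq (x y x' y' : C) :
  (x != 0) || (y != 0) -> (x' != 0) || (y' != 0) ->
  pt x y = pt x' y' <-> x * y' = x' * y.
Proof.
rewrite /pt; have [->|y0] := eqVneq y 0; have [->|y'0] := eqVneq y' 0.
- by rewrite !mulr0.
- rewrite orbF mulr0 => x0 _; split=> // /eqP.
  by rewrite mulf_eq0 (negPf x0) (negPf y'0).
- rewrite orbF mulr0 => _ x'0; split=> // /esym/eqP.
  by rewrite mulf_eq0 (negPf x'0) (negPf y0).
- move=> _ _; split=> [[/eqP]|/eqP]; first by rewrite eqr_div // => /eqP.
  by rewrite -eqr_div // => /eqP ->.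
Qed.

(* Polynomial functions of two variables; this form makes closure under
   substitution immediate. *)
Definition polyf (k : C -> C -> C) : Prop :=
  forall p q, exists r : {poly C}, forall t, k p.[t] q.[t] = r.[t].

(* [f] is given by a pair of polynomials in homogeneous coordinates; their
   homogeneity plays no role. *)
Definition projrat f : Prop := exists g1 g2 : C -> C -> C, [/\ polyf g1, polyf g2 &
  forall x y, (x != 0) || (y != 0) ->
    (g1 x y != 0) || (g2 x y != 0) /\ f (pt x y) = pt (g1 x y) (g2 x y)].

Lemma projrat_comp f g : projrat f -> projrat g -> projrat (f \o g).
Proof.
move=> [f1 [f2 [pf1 pf2 fE]]] [g1 [g2 [pg1 pg2 gE]]].
have pc k : polyf k -> polyf (fun x y => k (g1 x y) (g2 x y)).
  move=> pk p q; have [r1 r1E] := pg1 p q; have [r2 r2E] := pg2 p q.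
  by have [r rE] := pk r1 r2; exists r => t; rewrite r1E r2E rE.
exists (fun x y => f1 (g1 x y) (g2 x y)), (fun x y => f2 (g1 x y) (g2 x y)).
split; [exact: pc | exact: pc | move=> x y /gE[nz /= ->]].
exact: fE nz.
Qed.

Lemma projrat_id : projrat id.
Proof.
exists (fun x _ => x), (fun _ y => y).
by split=> // p q; [exists p | exists q].
Qed.

Lemma projrat_cst b : projrat (fun _ => b).
Proof.
have pc (c : C) : polyf (fun _ _ => c) by move=> p q; exists c%:P => t; rewrite hornerC.
case: b => [z|]; [exists (fun _ _ => z), (fun _ _ => 1) |
                  exists (fun _ _ => 1), (fun _ _ => 0)]; split=> // x y _.
- by rewrite oner_neq0 orbT /pt oner_eq0 divr1.
- by rewrite oner_neq0 /pt eqxx.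
Qed.

Definition homog (n : nat) p (x y : C) : C :=
  \sum_(i < n.+1) p`_i * x ^+ i * y ^+ (n - i).

Lemma homog_polyf n p : polyf (homog n p).
Proof.
move=> u v; exists (\sum_(i < n.+1) p`_i *: (u ^+ i * v ^+ (n - i))) => t.
rewrite horner_sum; apply: eq_bigr => i _.
by rewrite hornerZ hornerM !horner_exp mulrA.
Qed.

Lemma homogE n p (x y : C) : (size p <= n.+1)%N -> y != 0 ->
  homog n p x y = y ^+ n * p.[x / y].
Proof.
move=> sp y0; rewrite (horner_coef_wide _ sp) big_distrr /=.
apply: eq_bigr => i _; rewrite expr_div_n.
have in' : (i <= n)%N by rewrite -ltnS.
have -> : y ^+ n = y ^+ i * y ^+ (n - i) by rewrite -exprD subnKC.
by field; exact: expf_neq0.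
Qed.

Lemma homogx0 n p (x : C) : homog n p x 0 = p`_n * x ^+ n.
Proof.
rewrite /homog big_ord_recr /= subnn mulr1 big1 ?add0r // => i _.
by rewrite expr0n subn_eq0 leqNgt ltn_ord mulr0.
Qed.

Lemma fracdeg_size p q :
  (size p <= (fracdeg p q).+1)%N /\ (size q <= (fracdeg p q).+1)%N.
Proof.
rewrite /fracdeg; split; rewrite -maxnSS leq_max; apply/orP; [left | right];
  exact: leqSpred.
Qed.

Lemma coprimep_roots p q t : coprimep p q -> (p.[t] != 0) || (q.[t] != 0).
Proof.
move=> cpq; have [pt0|//] := eqVneq p.[t] 0.
by rewrite (coprimep_root cpq) // /root pt0.
Qed.

Lemma fracdeg_coef p q : coprimep p q ->
  (p`_(fracdeg p q) != 0) || (q`_(fracdeg p q) != 0).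
Proof.
move=> cpq; have : (p != 0) || (q != 0).
  apply: contraTT (coprimep_roots 0 cpq); rewrite negb_or !negbK.
  by move=> /andP[/eqP-> /eqP->]; rewrite horner0 eqxx.
rewrite /fracdeg -!lead_coef_eq0 !lead_coefE.
have [pq|/ltnW qp] := leqP (size p) (size q).
  have -> : maxn (size p).-1 (size q).-1 = (size q).-1.
    by apply/maxn_idPr; rewrite -!subn1 leq_sub2r.
  move=> /orP[]; last by move=> ->; rewrite orbT.
  rewrite -lead_coefE lead_coef_eq0 => p0; rewrite -lead_coefE lead_coef_eq0.
  by rewrite -(size_poly_gt0 q) (leq_trans _ pq) ?size_poly_gt0 // orbT.
have -> : maxn (size p).-1 (size q).-1 = (size p).-1.
  by apply/maxn_idPl; rewrite -!subn1 leq_sub2r.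
move=> /orP[->//|].
rewrite -lead_coefE lead_coef_eq0 => q0; rewrite -lead_coefE lead_coef_eq0.
by rewrite -(size_poly_gt0 p) (leq_trans _ qp) ?size_poly_gt0.
Qed.

(** Homogenise [p] and [q] at degree [fracdeg p q]: coprimality excludes common zeros at finite
    points, and at infinity one of the top coefficients is nonzero. *)
Lemma projrat_ratmap p q : coprimep p q -> projrat (ratmap p q).
Proof.
move=> cpq; set n := fracdeg p q.
have [sp sq] := fracdeg_size p q.
exists (homog n p), (homog n q); split; try exact: homog_polyf.
move=> x y; have [->|y0 _] := eqVneq y 0.
  rewrite orbF => x0; rewrite !homogx0 /pt eqxx /= -/n.
  have xn : x ^+ n != 0 by rewrite expf_neq0.
  rewrite !mulf_eq0 (negPf xn) !orbF; split; first exact: fracdeg_coef.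
  by case: ifP => // qn; congr Some; rewrite -mulf_div divff // mulr1.
have yn : y ^+ n != 0 by rewrite expf_neq0.
rewrite !homogE // !mulf_eq0 (negPf yn) !orFb; split; first exact: coprimep_roots.
rewrite /pt (negPf y0) /= mulf_eq0 (negPf yn) orFb.
by case: ifP => // qn; congr Some; rewrite -mulf_div divff // mul1r.
Qed.

(* The local parameter at [a]: [z - a], or [1/z] at infinity. The value of
   [coord b] at [None] is correct for [b = None] and a dummy otherwise. *)
Definition par (a : S) (t : C) : S :=
  if a is Some z then Some (z + t) else if t == 0 then None else Some t^-1.

Definition coord (b s : S) : C :=
  match s, b with
  | None, _ => 0
  | Some w, Some z => w - z
  | Some w, None => w^-1
  end.

Lemma par0 a : par a 0 = a.
Proof. by case: a => [z|] /=; rewrite ?addr0 ?eqxx. Qed.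

Lemma coordxx b : coord b b = 0.
Proof. by case: b => [z|] //=; rewrite subrr. Qed.

Definition loc f a (t : C) : C := coord (f a) (f (par a t)).

Lemma loc0 f a : loc f a 0 = 0.
Proof. by rewrite /loc par0 coordxx. Qed.

Lemma projrat_par f a : projrat f -> exists P Q : {poly C}, forall t,
  (P.[t] != 0) || (Q.[t] != 0) /\ f (par a t) = pt P.[t] Q.[t].
Proof.
have [u [v uvE]] : exists u v : {poly C}, forall t,
    (u.[t] != 0) || (v.[t] != 0) /\ par a t = pt u.[t] v.[t].
  case: a => [z|]; [exists (z%:P + 'X), 1 | exists 1, 'X] => t;
    rewrite !hornerE /pt ?oner_eq0 ?orbT ?divr1 //.
  by rewrite mul1r.
move=> [g1 [g2 [pg1 pg2 gE]]].
have [P PE] := pg1 u v; have [Q QE] := pg2 u v.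
by exists P, Q => t; have [nz ->] := uvE t; rewrite -PE -QE; exact: gE.
Qed.

(** With [f (par a t) = [P : Q]], use [P / Q] if [f a] is finite and [Q / P] if it is infinite. The
    denominator is nonzero at 0, and wherever it is nonzero the chart can be inverted. *)
Lemma loc_spec f a : projrat f ->
  germ (loc f a) /\ ae (fun t => f (par a t) = par (f a) (loc f a t)).
Proof.
move=> /(projrat_par a)[P [Q PQ]]; rewrite /loc.
have [nz0 fa] := PQ 0; rewrite par0 in fa.
have [Q0|Q0] := eqVneq Q.[0] 0; last first.
  set b := P.[0] / Q.[0].
  have {}fa : f a = Some b by rewrite fa /pt (negPf Q0).
  have E t : Q.[t] != 0 -> f (par a t) = Some (P.[t] / Q.[t]).
    by move=> Qt; have [_ ->] := PQ t; rewrite /pt (negPf Qt).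
  rewrite fa; split.
    exists (P - b%:P * Q), Q; split=> // t Qt.
    by rewrite E //= hornerD hornerN hornerM hornerC; field.
  by exists Q => // t Qt; rewrite E //= addrC subrK.
rewrite Q0 eqxx orbF in nz0.
have {}fa : f a = None by rewrite fa /pt Q0 eqxx.
have E t : P.[t] != 0 -> coord None (f (par a t)) = Q.[t] / P.[t].
  move=> Pt; have [_ ->] := PQ t; rewrite /pt.
  by case: eqVneq => [->|Qt] /=; rewrite ?mul0r ?invf_div.
rewrite fa; split; first by exists Q, P.
exists P => // t Pt; rewrite E //=; have [_ ->] := PQ t; rewrite /pt.
by rewrite mulf_eq0 invr_eq0 (negPf Pt) orbF invf_div.
Qed.

Lemma loc_comp f g a : projrat f -> projrat g ->
  ae (fun t => loc (g \o f) a t = loc g (f a) (loc f a t)).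
Proof.
move=> pf pg; have [_ ] := loc_spec a pf.
by move=> aef; apply: ae_imp aef _ => t; rewrite /loc /= => {1}->.
Qed.

(** Equality of [[P : Q]] and [[P' : Q']] means [P Q' = P' Q], a polynomial identity, which extends
    over a finite exceptional set. Infinity is reached through the parameter [1/z]. *)
Lemma projrat_eq A B (E : {poly C}) : projrat A -> projrat B -> E != 0 ->
  (forall z, E.[z] != 0 -> A (Some z) = B (Some z)) -> A = B.
Proof.
move=> pA pB nzE AB.
have cross a (E' : {poly C}) : E' != 0 ->
    (forall t, E'.[t] != 0 -> A (par a t) = B (par a t)) ->
    forall t, A (par a t) = B (par a t).
  move=> nzE' AB' t.
  have [P [Q PQ]] := projrat_par a pA; have [P' [Q' PQ']] := projrat_par a pB.
  have [nz ->] := PQ t; have [nz' ->] := PQ' t; apply/pt_eq => //.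
  have : E' * (P * Q' - P' * Q) = 0.
    apply: poly_fun0 => s; rewrite !hornerE.
    have [->|Es] := eqVneq E'.[s] 0; first by rewrite mul0r.
    have [nzs es] := PQ s; have [nzs' es'] := PQ' s.
    have := AB' s Es; rewrite es es' => /(pt_eq nzs nzs') ->.
    by rewrite subrr mulr0.
  move/eqP; rewrite mulf_eq0 (negPf nzE') /= subr_eq0 => /eqP.
  by move/(congr1 (horner^~ t)); rewrite !hornerM.
have ABfin z : A (Some z) = B (Some z).
  have := @cross (Some 0) E nzE _ z; rewrite /= add0r; apply=> t Et.
  by rewrite add0r; exact: AB.
apply/funext => -[z|] //.
have := @cross None 'X _ _ 0; rewrite /= eqxx; apply; first by rewrite polyX_eq0.
by move=> t; rewrite hornerX => /negPf ->.
Qed.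

Lemma loc_inj A B a : projrat A -> projrat B -> A a = B a ->
  ae (fun t => loc A a t = loc B a t) -> A = B.
Proof.
move=> pA pB ABa AB.
have [_ aeA] := loc_spec a pA; have [_ aeB] := loc_spec a pB.
have : ae (fun t => A (par a t) = B (par a t)).
  by apply: ae_imp (aeI AB (aeI aeA aeB)) _ => t [-> [-> ->]]; rewrite ABa.
move=> /ae_inf[D nzD DAB]; case: a {ABa AB aeA aeB} DAB => [z|] DAB.
  apply: (@projrat_eq _ _ (D \Po ('X - z%:P))) => //.
    by rewrite comp_poly2_eq0 // size_XsubC.
  move=> w; rewrite horner_comp !hornerE => /DAB /=.
  by rewrite addrC subrK.
(* [E] is the reciprocal polynomial of [D]: it turns conditions on [1/w] into conditions on [w]. *)
have [E EE] := homog_polyf (size D).-1 D 1 'X.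
have EE' w : w != 0 -> E.[w] = w ^+ (size D).-1 * D.[w^-1].
  move=> w0; have := EE w; rewrite hornerC hornerX => <-.
  by rewrite homogE ?leqSpred // mul1r.
apply: (@projrat_eq _ _ (E * 'X)) => //.
  apply: contraNneq nzD => /eqP; rewrite mulf_eq0 polyX_eq0 orbF => /eqP E0.
  have : D * 'X = 0.
    apply: poly_fun0 => t; rewrite hornerM hornerX.
    have [->|t0] := eqVneq t 0; first by rewrite mulr0.
    have := EE' t^-1; rewrite invr_eq0 => /(_ t0)/esym/eqP.
    rewrite E0 horner0 mulf_eq0 expf_eq0 invr_eq0 (negPf t0) andbF /= invrK.
    by move=> /eqP->; rewrite mul0r.
  by move/eqP; rewrite mulf_eq0 polyX_eq0 orbF.
move=> w; rewrite hornerM hornerX mulf_eq0 negb_or => /andP[].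
have [->|w0] := eqVneq w 0; rewrite // EE' // mulf_eq0 negb_or => /andP[_ Dw] _.
by have := DAB _ Dw; rewrite /= invr_eq0 (negPf w0) invrK.
Qed.

(** Surjectivity excludes constant maps and allows cancellation on the right, and it passes to
    compositions at once. *)
Definition ratsurj f : Prop := projrat f /\ (forall y, exists x, f x = y).

Lemma ratsurj_comp f g : ratsurj f -> ratsurj g -> ratsurj (f \o g).
Proof.
move=> [pf sf] [pg sg]; split; first exact: projrat_comp.
by move=> y; have [x <-] := sf y; have [z <-] := sg x; exists z.
Qed.

Lemma ratsurj_id : ratsurj id.
Proof. by split=> [|y]; [exact: projrat_id | exists y]. Qed.

Lemma ratsurj_iter f n : ratsurj f -> ratsurj (iter n f).
Proof.
move=> gf; elim: n => [|n IH]; first exact: ratsurj_id.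
exact: (ratsurj_comp gf IH).
Qed.

Lemma germ_loc f a : ratsurj f -> germ (loc f a).
Proof. by case=> /(loc_spec a)[]. Qed.

(** A vanishing expansion would make [f] constant by [loc_inj], contradicting surjectivity. *)
Lemma lead_loc f a : ratsurj f ->
  exists m e, [/\ (0 < m)%N, e != 0 & lead (loc f a) m e].
Proof.
move=> gf; have [f0|[m [e [e0 le]]]] := germ_lead (germ_loc a gf); last first.
  by exists m, e; split=> //; exact: (lead_pos (loc0 f a) e0 le).
have fE : f = fun _ => f a.
  apply: (@loc_inj _ _ a) => //; [by case: gf | exact: projrat_cst |].
  by apply: ae_imp f0 _ => t ->; rewrite /loc coordxx.
case: gf => _ sf; have [x fx] := sf None; have [y fy] := sf (Some 0).
by move: fx fy; rewrite fE => ->.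
Qed.

(* Order and leading coefficient of [f] at [a]; [(0, 0)] is a junk value, taken
   when [loc f a] vanishes identically. *)
Definition ldata f a : nat * C := xget (0%N, 0)
  [set me | [/\ (0 < me.1)%N, me.2 != 0 & lead (loc f a) me.1 me.2]].
Definition lord f a : nat := (ldata f a).1.
Definition lcoef f a : C := (ldata f a).2.

Lemma ldataP f a : ratsurj f ->
  [/\ (0 < lord f a)%N, lcoef f a != 0 & lead (loc f a) (lord f a) (lcoef f a)].
Proof.
move=> /(lead_loc a)[m [e me]]; rewrite /lord /lcoef /ldata.
by case: xgetP => [[n d] _ //|/(_ (m, e))].
Qed.

Lemma lord_lcoef f a m e : ratsurj f -> e != 0 -> lead (loc f a) m e ->
  lord f a = m /\ lcoef f a = e.
Proof.
move=> /(ldataP a)[m0 e0 le] e'0 le'; exact: (lead_uniq le le').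
Qed.

Lemma lead_loc_comp f g a m l e c : ratsurj f -> ratsurj g ->
  lead (loc g (f a)) m e -> lead (loc f a) l c -> (0 < l)%N ->
  lead (loc (g \o f) a) (l * m) (e * c ^+ m).
Proof.
move=> [pf _] [pg _] lg lf l0; apply: lead_ext (loc_comp a pf pg).
exact: lead_comp.
Qed.

Lemma ldata_comp f g a : ratsurj f -> ratsurj g ->
  lord (g \o f) a = (lord f a * lord g (f a))%N /\
  lcoef (g \o f) a = lcoef g (f a) * lcoef f a ^+ lord g (f a).
Proof.
move=> gf gg; have [l0 c0 lf] := ldataP a gf; have [m0 e0 lg] := ldataP (f a) gg.
apply: lord_lcoef; first exact: ratsurj_comp.
  by rewrite mulf_neq0 ?expf_neq0.
exact: lead_loc_comp.
Qed.

Lemma ldata_id a : lord id a = 1%N /\ lcoef id a = 1.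
Proof.
apply: lord_lcoef; [exact: ratsurj_id | exact: oner_neq0 |].
apply: lead_ext (@lead_id C) _; apply: aeT => t; rewrite /loc.
case: a => [z|] /=; first by rewrite addrC addKr.
by case: eqVneq => [->|] //=; rewrite invrK.
Qed.

(** A preimage of a finite [w] is a root of [p - w *: q], or infinity if the coefficient of degree
    [d] of this polynomial vanishes. For the value infinity, [q] takes its place. *)
Lemma rational_map_ratsurj f : rational_map f -> ratsurj f.
Proof.
move=> [d d0 [p [q [cpq dE ->]]]]; split; first exact: projrat_ratmap.
have [sp sq] := fracdeg_size p q; rewrite dE in sp sq.
have fdc := fracdeg_coef cpq; rewrite dE in fdc.
have szcst (u : {poly C}) : (size u <= 1)%N -> u`_d = 0.
  by move=> su; rewrite nth_default // (leq_trans su).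
have rt (u : {poly C}) : u`_d != 0 -> exists z, u.[z] = 0.
  move=> ud; have : size u != 1%N.
    by apply: contraNneq ud => su; rewrite szcst ?su.
  by move=> /closed_rootP[z /rootP uz]; exists z.
case=> [w|].
  have [/eqP pw|pw] := boolP ((p - w *: q)`_d == 0).
    exists None; rewrite /= dE; move: pw; rewrite coefB coefZ => /subr0_eq pw.
    have qd : q`_d != 0.
      by apply: contraTneq fdc => qd; rewrite pw qd mulr0 eqxx.
    by rewrite pw (negPf qd) mulfK.
  have [z] := rt _ pw; rewrite !hornerE => /subr0_eq pz.
  have qz : q.[z] != 0.
    apply: contraTneq (coprimep_roots z cpq) => qz.
    by rewrite pz qz mulr0 eqxx.
  by exists (Some z); rewrite /= pz (negPf qz) mulfK.
have [qd|qd] := eqVneq q`_d 0.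
  by exists None; rewrite /= dE qd eqxx.
by have [z qz] := rt _ qd; exists (Some z); rewrite /= qz eqxx.
Qed.

(** Infinity is fixed if [q] has degree below [d]; otherwise [p - q * 'X] has degree [d.+1] and its
    roots are fixed points. *)
Lemma rational_fixed_point f : rational_map f -> exists a, f a = a.
Proof.
move=> [d d0 [p [q [cpq dE ->]]]].
have [sp sq] := fracdeg_size p q; rewrite dE in sp sq.
have [qd|qd] := eqVneq q`_d 0; first by exists None; rewrite /= dE qd eqxx.
have : size (p - q * 'X) != 1%N.
  apply: contraNneq qd => s1.
  have : (p - q * 'X)`_d.+1 = 0 by rewrite nth_default ?s1.
  by rewrite coefB coefMX /= nth_default // sub0r => /eqP; rewrite oppr_eq0.
move=> /closed_rootP[z /rootP]; rewrite !hornerE => /subr0_eq pz.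
have qz : q.[z] != 0.
  apply: contraTneq (coprimep_roots z cpq) => qz.
  by rewrite pz qz mul0r eqxx.
by exists (Some z); rewrite /= pz (negPf qz) mulrC mulKf.
Qed.

(** Choose [z] off the zeros of [q] and of the Wronskian [p' q - p q'], and let [w = f z]. Then [z]
    is a simple root of [p - w *: q], so [w] has a second preimage, possibly infinity. *)
Lemma degree_gt1_not_injective f d : (1 < d)%N -> has_degree f d -> ~ injective f.
Proof.
move=> d1 [p [q [cpq dE fE]]] finj.
have [sp sq] := fracdeg_size p q; rewrite dE in sp sq.
have fdc := fracdeg_coef cpq; rewrite dE in fdc.
have deriv0 (u : {poly C}) : u`_d != 0 -> u^`() != 0.
  case: d d1 {dE sp sq fdc} => // d _ ud; apply: contraNneq ud => u0.
  have := coef_deriv u d; rewrite u0 coef0 => /esym/eqP.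
  by rewrite mulrn_eq0.
have dvd0 (u : {poly C}) : (u %| u^`())%R -> u`_d = 0.
  move=> uu; apply/eqP; apply: contraT => ud; have u'0 := deriv0 _ ud.
  have nzu : u != 0 by apply: contraNneq ud => ->; rewrite coef0.
  by have := dvdp_leq u'0 uu; rewrite leqNgt lt_size_deriv.
(* Otherwise coprimality would make [p] divide [p'] and [q] divide [q'], and both coefficients of
   degree [d] would vanish. *)
have nzW : p^`() * q - p * q^`() != 0.
  apply: contraTneq fdc => /subr0_eq W0.
  rewrite (dvd0 p) ?(dvd0 q) ?eqxx //.
    by rewrite -(Gauss_dvdpr _ (_ : coprimep q p)) 1?coprimep_sym // -W0 dvdp_mull.
  by rewrite -(Gauss_dvdpr _ cpq) mulrC W0 dvdp_mulr.
have nzq : q != 0.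
  apply: contraTneq fdc => q0; move: cpq; rewrite q0 coprimep0 => pc.
  have := eqp_size pc; rewrite size_poly1 => sp1.
  by rewrite coef0 eqxx orbF negbK nth_default // sp1 ltnW.
have [z] : exists z, ((p^`() * q - p * q^`()) * q).[z] <> 0.
  by apply/existsNP => /poly_fun0/eqP; rewrite mulf_eq0 (negPf nzW) (negPf nzq).
rewrite hornerM => /eqP; rewrite mulf_eq0 negb_or => /andP[Wz qz].
set w := p.[z] / q.[z].
have fz : f (Some z) = Some w by rewrite fE /= (negPf qz).
have [/eqP|pwd] := boolP ((p - w *: q)`_d == 0).
  rewrite coefB coefZ => /subr0_eq pw.
  have : f None = f (Some z).
    have qd : q`_d != 0.
      by apply: contraTneq fdc => qd; rewrite pw qd mulr0 eqxx.
    by rewrite fz fE /= dE pw (negPf qd) mulfK.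
  by move/finj.
have rz : root (p - w *: q) z.
  by rewrite /root !hornerE /w divfK // subrr.
have /factor_theorem[r rE] := rz.
have : size r != 1%N.
  apply: contraNneq pwd => r1.
  rewrite nth_default // rE; apply: leq_trans (size_polyMleq _ _) _.
  by rewrite r1 size_XsubC.
move=> /closed_rootP[z' rz'].
have pz' : p.[z'] = w * q.[z'].
  apply/eqP; rewrite -subr_eq0.
  have -> : p.[z'] - w * q.[z'] = (p - w *: q).[z'] by rewrite !hornerE.
  by rewrite rE hornerM (rootP rz') mul0r.
have qz' : q.[z'] != 0.
  apply: contraTneq (coprimep_roots z' cpq) => qz'.
  by rewrite pz' qz' mulr0 eqxx.
have : f (Some z') = f (Some z) by rewrite fz fE /= (negPf qz') pz' mulfK.
move=> /finj[zz']; subst z'.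
have : (p - w *: q)^`().[z] = 0.
  rewrite rE derivM derivXsubC !hornerE (rootP rz') subrr; ring.
rewrite derivB derivZ !hornerE => /subr0_eq p'z.
move: Wz; rewrite !hornerE p'z pz' => /eqP; apply; ring.
Qed.

(** The finite fixed points are roots of [P - 'X * Q], which vanishes identically only if [h] is the
    identity. This bounds the set of states, since words move [p] among fixed points of [h]. *)
Lemma fixed_points_finite h : projrat h -> h <> id ->
  exists L : seq S, forall a, h a = a -> a \in L.
Proof.
move=> ph hid; have [P [Q PQ]] := projrat_par (Some 0) ph.
have E z : h (Some z) = pt P.[z] Q.[z] by have [_ <-] := PQ z; rewrite /= add0r.
have [r rE] := closed_field_poly_normal (P - 'X * Q).
have [N0|nzN] := eqVneq (P - 'X * Q) 0.
  case: hid; apply: (@projrat_eq _ _ (Q)) => //; first exact: projrat_id.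
    apply/eqP => Q0; have [nz _] := PQ 0; move: N0 nz.
    by rewrite Q0 mulr0 subr0 => ->; rewrite !horner0 eqxx.
  move=> z Qz; rewrite E /pt (negPf Qz).
  have := congr1 (horner^~ z) N0; rewrite !hornerE => /subr0_eq ->.
  by rewrite mulfK.
exists (None :: [seq Some z | z <- r]) => -[z|] hz; rewrite inE //=.
apply: map_f; have : (P - 'X * Q).[z] = 0.
  move: hz; rewrite E /pt; case: eqVneq => // Qz [PQz].
  by rewrite !hornerE -[X in _ - X * _]PQz divfK // subrr.
rewrite rE hornerZ => /eqP; rewrite mulf_eq0 lead_coef_eq0 (negPf nzN) /=.
by have := root_prod_XsubC r z; rewrite /root => ->.
Qed.

End ProjectiveMaps.

(** * Counting words that commute with a map *)

Section CommutingMaps.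
Variable R : realType.
Local Notation C := R[i].
Local Notation S := (sphere R).
Implicit Types (f g h A B P : S -> S) (a x p q : S).

Lemma commute_fixed h A p : A \o h = h \o A -> h p = p -> h (A p) = A p.
Proof. by move=> Ah hp; have := congr1 (@^~ p) Ah; rewrite /= hp. Qed.

(** Compare leading terms in [A \o h = h \o A] at [p]; the factor [lord A p] cancels from the
    orders. *)
Lemma commute_ldata h A p : ratsurj h -> ratsurj A -> A \o h = h \o A -> h p = p ->
  lord h (A p) = lord h p /\
  lcoef A p * lcoef h p ^+ lord A p = lcoef h (A p) * lcoef A p ^+ lord h p.
Proof.
move=> gh gA Ah hp; have [A0 _ _] := ldataP p gA.
have [] := ldata_comp p gh gA; have [] := ldata_comp p gA gh.
rewrite Ah hp => -> -> /eqP; rewrite mulnC eqn_pmul2r // => /eqP ->.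
by move=> ->.
Qed.

Lemma commute_loc h A p : ratsurj h -> ratsurj A -> A \o h = h \o A -> h p = p ->
  ae (fun t => loc A p (loc h p t) = loc h (A p) (loc A p t)).
Proof.
move=> [ph _] [pA _] Ah hp.
apply: ae_imp (aeI (loc_comp p ph pA) (loc_comp p pA ph)) _ => t.
by rewrite hp Ah => -[<- <-].
Qed.

(* Compare the two expansions of [A \o h - B \o h = h \o A - h \o B] at [p]. *)
Lemma commute_inj h A B p : ratsurj h -> ratsurj A -> ratsurj B ->
  A \o h = h \o A -> B \o h = h \o B -> h p = p -> A p = B p ->
  lord A p = lord B p -> lcoef A p = lcoef B p ->
  (1 < lord h p)%N \/ (forall n, (0 < n)%N -> lcoef h p ^+ n != 1) -> A = B.
Proof.
move=> gh gA gB Ah Bh hp AB lAB cAB hk.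
have [pA _] := gA; have [pB _] := gB.
have [l0 c0 leA] := ldataP p gA; have [_ _ leB] := ldataP p gB.
rewrite -lAB -cAB in leB.
have [lhE hE] := commute_ldata gh gA Ah hp.
have [k0 a0 leh] := ldataP p gh; have [_ a'0 leh'] := ldataP (A p) gh.
rewrite lhE in leh'.
set k := lord h p in hk lhE hE k0 leh leh' *.
set a := lcoef h p in hk hE a0 leh *; set a' := lcoef h (A p) in hE a'0 leh' *.
set c := lcoef A p in c0 leA leB hE; set l := lord A p in l0 leA leB hE.
have [D0|[m [e [e0 leD]]]] := germ_lead (germB (germ_loc p gA) (germ_loc p gB)).
  apply: (@loc_inj _ _ _ p) => //.
  by apply: ae_imp D0 _ => t /subr0_eq.
have lm : (l < m)%N.
  by have := leadB leA leB; rewrite subrr => le0; exact: lead_gt le0 leD e0.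
(* The orders give [k m = m + l (k-1)], that is [(k-1)(m-l) = 0], so [k = 1]. The coefficients then
   give [a^m = a'], while [hE] gives [a' = a^l]; hence [a^(m-l) = 1]. *)
have X := lead_comp k0 leD leh.
have Y := lead_sub k0 l0 leh' leA leB leD.
have [|||kE cE] := lead_uniq X (lead_ext Y _).
- apply: ae_imp (aeI (commute_loc gh gA Ah hp) (commute_loc gh gB Bh hp)) _.
  by move=> t [-> ->]; rewrite AB.
- by rewrite mulf_neq0 ?expf_neq0.
- by rewrite !(mulf_neq0, expf_neq0, mulrn_eq0) // negb_or -lt0n k0 mulf_neq0 ?expf_neq0.
case: (ltngtP k 1%N) hk => [|k1 _|k1 [//|]]; first by rewrite ltnS leqn0 eqn0Ngt k0.
  exfalso; move: kE k1 lm; case: (k) => // k' /=.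
  by move: (m) (l) => m' l' ? ? ?; nia.
move=> /(_ (m - l)%N); rewrite subn_gt0 lm => /(_ isT)/eqP[].
rewrite k1 /= expr0 mulr1 mulr1n in cE.
rewrite k1 expr1 mulrC in hE; have {}hE := mulIf c0 hE.
apply: (mulIf (expf_neq0 l a0)); rewrite -exprD subnK ?(ltnW lm) // mul1r hE.
exact: mulfI cE.
Qed.

(** In local coordinates [A \o h - A = (h - id) \o A]: the left side starts with [c d t^k], the
    right side with [d' c^k' t^k']. *)
Lemma commute_parabolic h A p (k k' : nat) (c d d' : C) :
  ratsurj h -> ratsurj A -> A \o h = h \o A -> h p = p ->
  lead (loc h p) 1 1 -> lead (loc A p) 1 c -> c != 0 ->
  lead (fun t => loc h p t - t) k d -> d != 0 ->
  lead (fun t => loc h (A p) t - t) k' d' -> d' != 0 ->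
  k = k' /\ d = d' * c ^+ k.-1.
Proof.
move=> gh gA Ah hp leh leA c0 led d0 led' d'0.
have X := lead_sub (ltnSn 0) (ltnSn 0) leA leh (@lead_id C) led.
have Y := lead_comp (ltnSn 0) led' leA.
rewrite /= muln0 addn0 expr0 mulr1 mulr1n in X; rewrite mul1n in Y.
have [|||kk dE] := lead_uniq X (lead_ext Y _).
- by apply: ae_imp (commute_loc gh gA Ah hp) _ => t ->.
- by rewrite mulf_neq0.
- by rewrite mulf_neq0 ?expf_neq0.
have k0 : (0 < k)%N by apply: lead_pos d0 led; rewrite loc0 subrr.
split=> //; apply: (mulIf c0); rewrite dE -kk -mulrA -exprSr prednK //.
Qed.

(* Two maps commuting with [z + d z^k + ...] and having the same 1-jet can only
   differ at order [k]. *)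
Lemma commute_parabolic_diff h A B p (k : nat) (c d d' : C) :
  ratsurj h -> ratsurj A -> ratsurj B ->
  A \o h = h \o A -> B \o h = h \o B -> h p = p -> A p = B p ->
  lead (loc h p) 1 1 -> lead (loc A p) 1 c -> lead (loc B p) 1 c -> c != 0 ->
  lead (fun t => loc h p t - t) k d -> d != 0 ->
  lead (fun t => loc h (A p) t - t) k d' -> d' != 0 ->
  exists2 e, lead (fun t => loc A p t - loc B p t) k e & (e = 0 -> A = B).
Proof.
move=> gh gA gB Ah Bh hp AB leh leA leB c0 led d0 led' d'0.
have [pA _] := gA; have [pB _] := gB.
have [_ dE] := commute_parabolic gh gA Ah hp leh leA c0 led d0 led' d'0.
have k0 : (0 < k)%N by apply: lead_pos d0 led; rewrite loc0 subrr.
have [D0|[m [e [e0 leD]]]] := germ_lead (germB (germ_loc p gA) (germ_loc p gB)).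
  exists 0.
    exists (fun _ => 0); split=> //; first exact: germ_cst.
    by apply: ae_imp D0 _ => t ->; rewrite mulr0.
  move=> _; apply: (@loc_inj _ _ _ p) => //.
  by apply: ae_imp D0 _ => t /subr0_eq.
exists e; last by move=> e00; rewrite e00 eqxx in e0.
have m0 : (0 < m)%N by apply: lead_pos e0 leD; rewrite !loc0 subrr.
(* With [D = A - B], equate [D \o h - D] and [(h - id) \o A - (h - id) \o B]. The orders agree
   automatically; the coefficients [m e d] and [k e d' c^(k-1)], where [d = d' c^(k-1)], force
   [m = k]. *)
have X := lead_sub m0 (ltnSn 0) leD leh (@lead_id C) led.
have Y := lead_sub k0 (ltnSn 0) led' leA leB leD.
have [|||_ cE] := lead_uniq X (lead_ext Y _).
- apply: ae_imp (aeI (commute_loc gh gA Ah hp) (commute_loc gh gB Bh hp)) _.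
  by move=> t /= [-> ->]; rewrite AB; ring.
- by rewrite expr1n mulr1 mulf_neq0 // mulrn_eq0 negb_or -lt0n m0.
- by rewrite mulf_neq0 // mulrn_eq0 negb_or -lt0n k0 mulf_neq0 ?expf_neq0.
rewrite -dE expr1n mulr1 mulrnAr [RHS]mulrnAr mulrC in cE.
have /eqP : (e * d) * (m%:R - k%:R) = 0.
  by rewrite mulrBr !mulr_natr cE subrr.
rewrite !mulf_eq0 (negPf e0) (negPf d0) /= subr_eq0 eqr_nat => /eqP mk.
by rewrite mk in leD.
Qed.

End CommutingMaps.

(** * Polynomial growth for letters with a common iterate *)

Section WordGrowth.
Variable R : realType.
Local Notation C := R[i].
Local Notation S := (sphere R).
Variables (h : S -> S) (p : S) (Ks : seq (S -> S)) (L : seq S).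
Hypothesis gh : ratsurj h.
Hypothesis hp : h p = p.
Hypothesis KsP : forall P, P \in Ks -> ratsurj P /\ exists m, iter m.+1 P = h.
Hypothesis LP : forall x, h x = x -> x \in L.

Local Notation ev := (@compose_word S).

Lemma letter_commute P : P \in Ks -> P \o h = h \o P.
Proof.
by move=> /KsP[_ [m <-]]; apply/funext => x; rewrite /= -iterSr.
Qed.

Lemma word_ratsurj w : all (mem Ks) w -> ratsurj (ev w).
Proof.
elim: w => [_|P w IH /= /andP[/KsP[gP _] /IH gw]]; first exact: ratsurj_id.
exact: ratsurj_comp.
Qed.

Lemma word_commute w : all (mem Ks) w -> ev w \o h = h \o ev w.
Proof.
elim: w => //= P w IH /andP[/letter_commute Ph /IH wh].
by rewrite -compA wh compA Ph.
Qed.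

Lemma word_fixed w : all (mem Ks) w -> h (ev w p) = ev w p.
Proof. by move=> /word_commute wh; exact: commute_fixed. Qed.

Lemma word_lord w : all (mem Ks) w ->
  lord (ev w) p = (\prod_(y <- transitions (fun v => ev v p) w) lord y.1 y.2)%N.
Proof.
elim: w => [_|P w IH /= /andP[PK wK]].
  by rewrite big_nil; have [] := ldata_id p.
rewrite big_cons /= -IH // mulnC; have [gP _] := KsP PK.
by have [] := ldata_comp p (word_ratsurj wK) gP.
Qed.

Lemma word_ldata w : all (mem Ks) w ->
  lord h (ev w p) = lord h p /\
  lcoef (ev w) p * lcoef h p ^+ lord (ev w) p
    = lcoef h (ev w p) * lcoef (ev w) p ^+ lord h p.
Proof.
by move=> wK; apply: commute_ldata => //; [exact: word_ratsurj | exact: word_commute].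
Qed.

(** The orders of [P] along the orbit of [x] multiply to [lord h x = 1]. *)
Lemma letter_lord P x : P \in Ks -> lord h x = 1%N -> lord P x = 1%N.
Proof.
move=> /KsP[gP [m hE]] h1.
have hE' : h = iter m P \o P by apply/funext => y; rewrite -hE iterSr.
have [] := ldata_comp x gP (ratsurj_iter m gP).
by rewrite -hE' h1 => /esym/eqP; rewrite muln_eq1 => /andP[/eqP].
Qed.

Lemma word_lord1 w : lord h p = 1%N -> all (mem Ks) w -> lord (ev w) p = 1%N.
Proof.
move=> h1; elim: w => [_|P w IH /= /andP[PK wK]]; first by have [] := ldata_id p.
have [gP _] := KsP PK; have [lE _] := word_ldata wK.
have [-> _] := ldata_comp p (word_ratsurj wK) gP.
by rewrite IH // (letter_lord PK) // lE.
Qed.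

Lemma transitions_map (V : eqType) (s : (S -> S) -> V) (s1 : V -> S) w :
  (forall v, s1 (s (ev v)) = ev v p) ->
  [seq (y.1, s1 y.2) | y <- transitions (fun v => s (ev v)) w] =
  transitions (fun v => ev v p) w.
Proof. by move=> sE; elim: w => //= P w ->; rewrite sE. Qed.

(** All orders are 1, so leading coefficients multiply along a word; [commute_inj] recovers the map
    from this product and the image of [p]. *)
Lemma poly_growth_linearizable : lord h p = 1%N ->
  (forall n, (0 < n)%N -> lcoef h p ^+ n != 1) -> poly_growth ev Ks.
Proof.
move=> h1 hroot; apply: (poly_growth_transitions (st := fun w => ev w p) (L := L)).
  by move=> w wK; apply: LP; exact: word_fixed.
have cE w : all (mem Ks) w -> lcoef (ev w) p =
    \prod_(y <- transitions (fun v => ev v p) w) lcoef y.1 y.2.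
  elim: w => [_|P w IH /= /andP[PK wK]].
    by rewrite big_nil; have [] := ldata_id p.
  rewrite big_cons /= -IH //; have [gP _] := KsP PK.
  have [_ ->] := ldata_comp p (word_ratsurj wK) gP.
  by rewrite (letter_lord PK) //; have [-> _] := word_ldata wK.
move=> w w' wK w'K ww' tr.
apply: (commute_inj gh _ _ _ _ hp ww'); [exact: word_ratsurj | exact: word_ratsurj |
  exact: word_commute | exact: word_commute | by rewrite !word_lord1 | |].
  by rewrite !cE // (perm_big _ tr).
by right.
Qed.

(* At a superattracting point, rescaling the coordinate at each fixed point so
   that [h] becomes [t^k + ...] turns the leading coefficient of a commuting map
   into a (k-1)-st root of unity. *)
Lemma poly_growth_superattracting : (1 < lord h p)%N -> poly_growth ev Ks.
Proof.
set k := lord h p => k1.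
have k10 : (0 < k.-1)%N by case: (k) k1 => [|[]].
pose beta x : C := k.-1.-root (lcoef h x).
have betaE x : beta x ^+ k.-1 = lcoef h x by rewrite rootCK.
have beta0 x : beta x != 0.
  have [_ + _] := ldataP x gh; rewrite -betaE.
  by apply: contraNneq => ->; rewrite expr0n eqn0Ngt k10.
pose st (A : S -> S) : S * C :=
  (A p, lcoef A p * beta (A p) / beta p ^+ lord A p).
have [r rE] := closed_field_poly_normal ('X^(k.-1) - 1%:P : {poly C}).
apply: (poly_growth_transitions (st := fun w => st (ev w))
         (L := [seq (x, z) | x <- L, z <- r])).
  move=> w wK; apply/allpairsP; exists (st (ev w)); split; last by rewrite -surjective_pairing.
    by apply: LP; exact: word_fixed.
  have [_ c0 _] := ldataP p (word_ratsurj wK).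
  have [_ cE] := word_ldata wK.
  rewrite -root_prod_XsubC.
  have -> : \prod_(z <- r) ('X - z%:P) = 'X^(k.-1) - 1%:P.
    by rewrite [RHS]rE lead_coefXnsubC // scale1r.
  (* The relation [cE] between leading coefficients says exactly that the [k.-1]-st power of the
     normalised coefficient is 1. *)
  rewrite /root !hornerE subr_eq0 /= expr_div_n exprMn betaE exprAC betaE.
  have [_ a0 _] := ldataP p gh.
  apply/eqP; apply: (mulIf (expf_neq0 (lord (ev w) p) a0)).
  rewrite divfK ?expf_neq0 // mul1r; apply: (mulfI c0); rewrite cE.
  by rewrite mulrA -exprS prednK ?(ltnW k1) // mulrC.
move=> w w' wK w'K [ww' cE] tr.
(* The transitions fix the order of the word, and knowing the order undoes the normalisation of its
   leading coefficient. *)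
have lE : lord (ev w) p = lord (ev w') p.
  rewrite !word_lord // -!(@transitions_map _ st fst) // !big_map.
  exact: perm_big.
apply: (commute_inj gh _ _ _ _ hp ww') => //; [exact: word_ratsurj | exact: word_ratsurj |
  exact: word_commute | exact: word_commute | | by left].
move: cE; rewrite lE ww' => cE.
apply: (mulIf (beta0 (ev w' p))).
by apply: (mulIf (_ : (beta p ^+ lord (ev w') p)^-1 != 0)); rewrite ?invr_eq0 ?expf_neq0.
Qed.

(** The states are the 1-jets [(A p, lcoef A p)], finite in number because [A p] determines
    [lcoef A p ^+ k.-1]. Given the 1-jet, one coefficient at order [k] remains free, by
    [commute_parabolic_diff]. *)
Lemma poly_growth_parabolic : h <> id -> lord h p = 1%N -> lcoef h p = 1 ->
  poly_growth ev Ks.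
Proof.
move=> hid h1 c1.
have leh : lead (loc h p) 1 1 by have [_ _] := ldataP p gh; rewrite h1 c1.
have parE x : h x = x -> exists m e, e != 0 /\ lead (fun t => loc h x t - t) m e.
  move=> hx; have [D0|//] := germ_lead (germB (germ_loc x gh) (germ_id C)).
  case: hid; apply: (@loc_inj _ _ _ x) => //; [by case: gh | exact: projrat_id |].
  apply: ae_imp D0 _ => t /subr0_eq ->.
  rewrite /loc /=; case: (x) => [z|] /=; first by rewrite addrC addKr.
  by case: eqVneq => [->|] //=; rewrite invrK.
have [k [d [d0 led]]] := parE p hp.
(* By [commute_parabolic] the order [k] is the same at every image [A p]; [dd] is the coefficient
   there. *)
pose dd x : C := xget 0 [set e | e != 0 /\ lead (fun t => loc h x t - t) k e].
pose comm (A : S -> S) := [/\ ratsurj A, A \o h = h \o A & lord A p = 1%N].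
have leA A : comm A -> lead (loc A p) 1 (lcoef A p).
  by move=> [gA _ A1]; have [_ _] := ldataP p gA; rewrite A1.
have cA0 A : comm A -> lcoef A p != 0 by move=> [gA _ _]; have [] := ldataP p gA.
have word_comm w : all (mem Ks) w -> comm (ev w).
  by move=> wK; split; [exact: word_ratsurj | exact: word_commute | exact: word_lord1].
have ddP A : comm A -> [/\ dd (A p) != 0,
    lead (fun t => loc h (A p) t - t) k (dd (A p))
    & d = dd (A p) * lcoef A p ^+ k.-1].
  move=> cA; have [gA Ah A1] := cA.
  have [m [e [e0 lee]]] := parE _ (commute_fixed Ah hp).
  have [km _] := commute_parabolic gh gA Ah hp leh (leA _ cA) (cA0 _ cA) led d0 lee e0.
  rewrite -km in lee.
  have [dx0 dxl] : dd (A p) != 0 /\ lead (fun t => loc h (A p) t - t) k (dd (A p)).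
    by rewrite /dd; case: xgetP => [y _ //|/(_ e)[]].
  split=> //.
  by have [] := commute_parabolic gh gA Ah hp leh (leA _ cA) (cA0 _ cA) led d0 dxl dx0.
pose st (A : S -> S) : S * C := (A p, lcoef A p).
have diff A B : comm A -> comm B -> st A = st B ->
    exists2 e, lead (fun t => loc A p t - loc B p t) k e & (e = 0 -> A = B).
  move=> cA cB [AB ccAB]; have [gA Ah _] := cA; have [gB Bh _] := cB.
  have [dx0 dxl _] := ddP A cA.
  apply: (commute_parabolic_diff gh gA gB Ah Bh hp AB leh (leA _ cA) _ (cA0 _ cA)
           led d0 dxl dx0).
  by rewrite ccAB; exact: leA.
(* [del A] is the coefficient of t^k in the difference of [A] and a reference
   map with the same 1-jet; [del A / lcoef A p] is additive along words. *)
pose Ref (s : S * C) : S -> S := xget (id : S -> S) [set A : S -> S | comm A /\ st A = s].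
have RefP A : comm A -> comm (Ref (st A)) /\ st (Ref (st A)) = st A.
  by move=> cA; rewrite /Ref; case: xgetP => [B _ //|/(_ A)[]].
pose del A : C := xget 0 [set e | lead (fun t => loc A p t - loc (Ref (st A)) p t) k e].
have delP A : comm A ->
    lead (fun t => loc A p t - loc (Ref (st A)) p t) k (del A).
  move=> cA; have [cR sR] := RefP A cA.
  have [e lee _] := diff _ _ cA cR (esym sR).
  by rewrite /del; case: xgetP => [y _ //|/(_ e)[]].
have del_inj A B : comm A -> comm B -> st A = st B -> del A = del B -> A = B.
  move=> cA cB sAB dAB; have [e lee eP] := diff _ _ cA cB sAB.
  apply: eP; apply: (lead_inj lee).
  rewrite -(subrr (del A)) {2}dAB.
  apply: lead_ext (leadB (delP A cA) (delP B cB)) _; apply: aeT => t /=.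
  rewrite sAB; ring.
have comm_letter P A : P \in Ks -> comm A ->
    comm (P \o A) /\ st (P \o A) = (P (A p), lcoef P (A p) * lcoef A p).
  move=> PK cA; have [gA Ah A1] := cA; have [gP _] := KsP PK.
  have [lE _] := commute_ldata gh gA Ah hp.
  have P1 : lord P (A p) = 1%N by apply: letter_lord; rewrite ?lE.
  have [lPA cPA] := ldata_comp p gA gP.
  split; last by rewrite /st cPA P1.
  split; [exact: ratsurj_comp | | by rewrite lPA A1 P1].
  by rewrite -compA Ah compA (letter_commute PK).
(* The contribution of the letter [P] applied to the reference map of state [s], normalised by the
   derivative of the composite. *)
pose inc P (s : S * C) : C := del (P \o Ref s) / (lcoef P s.1 * s.2).
have del_step P A : P \in Ks -> comm A ->
    del (P \o A) / lcoef (P \o A) p = del A / lcoef A p + inc P (st A).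
  move=> PK cA; have [gA Ah A1] := cA; have [gP _] := KsP PK.
  have [cR sR] := RefP A cA; have [gR Rh R1] := cR; have [Rp Rc] := sR.
  have [cPA sPA] := comm_letter P A PK cA.
  have [cPR sPR] := comm_letter P _ PK cR.
  have sE : st (P \o Ref (st A)) = st (P \o A) by rewrite sPA sPR Rp Rc.
  have [lE _] := commute_ldata gh gA Ah hp.
  have P1 : lord P (A p) = 1%N by apply: letter_lord; rewrite ?lE.
  have [_ b0 leP] := ldataP (A p) gP; rewrite P1 in leP.
  set b := lcoef P (A p) in b0 leP.
  have leR := leA _ cR; rewrite Rc in leR.
  have lsub := lead_sub (ltnSn 0) (ltnSn 0) leP (leA _ cA) leR (delP A cA).
  rewrite /= muln0 addn0 expr0 mulr1 mulr1n in lsub.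
  (* Go from [P \o A] to its reference through [P \o Ref (st A)], which has the same 1-jet: the
     first difference has coefficient [del A * b], the second is again a [del]. *)
  have dPA : del (P \o A) = del A * b + del (P \o Ref (st A)).
    apply: (lead_inj (delP _ cPA)).
    apply: lead_ext (leadD lsub (delP _ cPR)) _.
    have [pP _] := gP; have [pA _] := gA; have [pR _] := gR.
    apply: ae_imp (aeI (loc_comp p pA pP) (loc_comp p pR pP)) _ => t [-> ->].
    rewrite Rp sE; ring.
  have -> : lcoef (P \o A) p = b * lcoef A p by case: sPA.
  rewrite /inc dPA /=; have := cA0 _ cA; move: (lcoef A p) => c c0.
  by field; rewrite b0 c0.
have del_word w : all (mem Ks) w -> del (ev w) / lcoef (ev w) p =
    del id / lcoef id p + \sum_(y <- transitions (fun v => st (ev v)) w) inc y.1 y.2.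
  elim: w => [_|P w IH /= /andP[PK wK]]; first by rewrite big_nil addr0.
  rewrite big_cons -/(ev w) del_step // ?IH //; last exact: word_comm.
  by rewrite -addrA [X in _ + X]addrC.
pose rts x := sval (closed_field_poly_normal ('X^(k.-1) - (d / dd x)%:P)).
(* [h - id] has no linear term. Hence the equation for the derivative has positive degree and
   finitely many roots. *)
have k2 : (1 < k)%N.
  by apply: (lead_gt _ led d0); have := leadB leh (@lead_id C); rewrite subrr.
have k10 : (0 < k.-1)%N by case: (k) k2 => [|[]].
apply: (poly_growth_transitions (st := fun w => st (ev w))
         (L := [seq (x, z) | x <- L, z <- rts x])).
  move=> w wK; apply/allpairsPdep; exists (ev w p), (lcoef (ev w) p).
  have [dx0 _ dE] := ddP _ (word_comm w wK).
  split=> //; first by apply: LP; exact: word_fixed.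
  rewrite -root_prod_XsubC /rts; case: closed_field_poly_normal => r /= rE.
  have -> : \prod_(z <- r) ('X - z%:P) = 'X^(k.-1) - (d / dd (ev w p))%:P.
    by rewrite rE lead_coefXnsubC // scale1r.
  by rewrite /root !hornerE subr_eq0 [X in _ == X / _]dE mulrC mulKf.
move=> w w' wK w'K sww' tr.
apply: del_inj => //; try exact: word_comm.
have := del_word w wK; rewrite (perm_big _ tr) -del_word //; case: sww' => _ ->.
have := cA0 _ (word_comm _ w'K) => c0 e.
by apply: (mulIf (_ : (lcoef (ev w') p)^-1 != 0)); rewrite ?invr_eq0.
Qed.

End WordGrowth.

(** The three cases for the expansion of [h] at [p]. If the multiplier is an [r]-th root of unity,
    [h] is replaced by [iter r h], which has multiplier 1 and is still an iterate of every
    letter. *)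
Lemma poly_growth_words (R : realType) (h : sphere R -> sphere R) (p : sphere R)
    (Ks : seq (sphere R -> sphere R)) :
  ratsurj h -> h p = p -> (forall n, (0 < n)%N -> iter n h <> id) ->
  (forall P, P \in Ks -> ratsurj P /\ exists m, iter m.+1 P = h) ->
  poly_growth (@compose_word (sphere R)) Ks.
Proof.
move=> gh hp hid KsP.
have [L LP] := fixed_points_finite (proj1 gh) (hid 1%N isT).
have [k0 _ _] := ldataP p gh.
have [k1|k1] := ltnP 1 (lord h p).
  exact: (poly_growth_superattracting gh hp KsP LP).
have {k0}k1 : lord h p = 1%N by apply/eqP; rewrite eqn_leq k1 k0.
have [hroot|] := pselect (forall n, (0 < n)%N -> lcoef h p ^+ n != 1).
  exact: (poly_growth_linearizable gh hp KsP LP).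
move=> /existsNP[r /not_implyP[r0 /negP/negPn/eqP cr]].
pose H := iter r h.
have gH : ratsurj H by exact: ratsurj_iter.
have Hp : H p = p by exact: iter_fix.
have [L' LP'] := fixed_points_finite (proj1 gH) (hid r r0).
have [H1 Hc] : lord H p = 1%N /\ lcoef H p = lcoef h p ^+ r.
  rewrite /H; elim: (r) => [|n [IH1 IH2]] /=; first exact: ldata_id.
  have [] := ldata_comp p (ratsurj_iter n gh) gh.
  rewrite (iter_fix n hp) => -> ->; rewrite IH1 IH2 k1; split=> //.
  by rewrite expr1 exprS.
apply: (poly_growth_parabolic gH Hp _ LP') => //; [|exact: hid | by rewrite Hc].
move=> P /KsP[gP [m mh]]; split=> //; exists (r * m.+1).-1.
rewrite prednK ?muln_gt0 ?r0 //; apply/funext => x.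
by rewrite iterM mh.
Qed.

(** * Invariant means from Folner sets *)

Import Normc.
Import numFieldNormedType.Exports.

Local Open Scope classical_set_scope.

Section FolnerSets.
Variables (R : realType) (S : semigroupType).
Implicit Types (f g : S -> R) (s : S) (W V : seq S).

(** Almost invariance is expressed through a container: [W] and its one-to-one translates lie in
    [V], larger than [W] by a factor of at most [1 + 1/(N+1)]. *)
Definition folner (gens : set S) : Prop :=
  forall (K : seq S) (N : nat), (forall s, s \in K -> gens s) ->
  exists W V, [/\ uniq W, uniq V, (0 < size W)%N,
    {subset W <= V} /\ (size V * N.+1 <= size W * N.+2)%N
    & forall s, s \in K ->
      [/\ {in W &, injective (fun x => s * x)%g}, {in W &, injective (fun x => x * s)%g}
        & forall x, x \in W -> (s * x)%g \in V /\ (x * s)%g \in V]].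

Definition average W f : R := (\sum_(x <- W) f x) / (size W)%:R.

Lemma sum_subseq_bound f (M : R) W V : uniq W -> uniq V -> {subset W <= V} ->
  (forall x, `|f x| <= M) ->
  `|\sum_(x <- V) f x - \sum_(x <- W) f x| <= M * ((size V)%:R - (size W)%:R).
Proof.
move=> uW uV WV fM.
have VE : perm_eq V (W ++ [seq x <- V | x \notin W]).
  rewrite uniq_perm // ?cat_uniq ?uW ?filter_uniq //= ?andbT.
    by apply/hasPn => x; rewrite mem_filter => /andP[].
  move=> x; rewrite mem_cat mem_filter.
  by have [/WV|] := boolP (x \in W).
rewrite (perm_size VE) size_cat natrD (perm_big _ VE) big_cat /=.
rewrite ![_ + _ - _]addrAC !subrr !add0r.
apply: le_trans (ler_norm_sum _ _ _) _.
apply: le_trans (ler_sum _ (fun x _ => fM x)) _.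
by rewrite big_const_seq count_predT iter_addr addr0 mulr_natr.
Qed.

Lemma average_bound f (M : R) W : (0 < size W)%N ->
  (forall x, `|f x| <= M) -> `|average W f| <= M.
Proof.
move=> W0 fM; rewrite /average normrM normfV normr_nat.
rewrite ler_pdivrMr ?ltr0n //.
apply: le_trans (ler_norm_sum _ _ _) _.
apply: le_trans (ler_sum _ (fun x _ => fM x)) _.
by rewrite big_const_seq count_predT iter_addr addr0 mulr_natr.
Qed.

(** [W] and [map tau W] have the same size inside [V], and each misses at most [size W / N.+1] of
    its points. *)
Lemma average_translate f (M : R) (N : nat) (tau : S -> S) W V :
  uniq W -> uniq V -> (0 < size W)%N -> {subset W <= V} ->
  (size V * N.+1 <= size W * N.+2)%N -> {in W &, injective tau} ->
  (forall x, x \in W -> tau x \in V) -> (forall x, `|f x| <= M) ->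
  `|average W (f \o tau) - average W f| <= 2 * M / N.+1%:R.
Proof.
move=> uW uV W0 WV VN tinj tV fM.
have M0 : 0 <= M.
  by case: (W) W0 => // x _ _; apply: le_trans (fM x).
rewrite /average -mulrBl normrM normfV normr_nat ler_pdivrMr ?ltr0n //.
have -> : \sum_(x <- W) (f \o tau) x = \sum_(x <- map tau W) f x.
  by rewrite big_map.
have b1 := sum_subseq_bound uW uV WV fM.
have b2 : `|\sum_(x <- V) f x - \sum_(x <- map tau W) f x| <=
    M * ((size V)%:R - (size W)%:R).
  rewrite -(size_map tau W); apply: sum_subseq_bound => //.
    by rewrite map_inj_in_uniq.
  by move=> _ /mapP[x xW ->]; exact: tV.
have VN' : ((size V)%:R - (size W)%:R : R) * N.+1%:R <= (size W)%:R.
  have : (size V)%:R * N.+1%:R <= (size W)%:R * N.+2%:R :> R.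
    by rewrite -!natrM ler_nat.
  rewrite (_ : N.+2%:R = N.+1%:R + 1 :> R) ?natr1 //; lra.
set a := \sum_(x <- map tau W) f x in b2 *; set b := \sum_(x <- W) f x in b1 *.
set c := \sum_(x <- V) f x in b1 b2.
have N0 : 0 < N.+1%:R :> R by rewrite ltr0n.
have ab : `|a - b| <= 2 * (M * ((size V)%:R - (size W)%:R)).
  have -> : a - b = (c - b) - (c - a) by ring.
  apply: le_trans (ler_normB _ _) _; lra.
apply: le_trans ab _; rewrite mulrA -!mulrA ler_pM2l ?ltr0n //.
by rewrite ler_wpM2l // ler_pdivlMl // mulrC.
Qed.

Lemma averageD (a : R) f g W :
  average W (fun x => a * f x + g x) = a * average W f + average W g.
Proof. by rewrite /average big_split /= -big_distrr /= mulrDl mulrA. Qed.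

Lemma average1 W : (0 < size W)%N -> average W (fun=> 1) = 1.
Proof.
move=> W0; rewrite /average big_const_seq count_predT iter_addr addr0.
by rewrite divff // pnatr_eq0 -lt0n.
Qed.

Lemma average_ge0 f W : (forall x, 0 <= f x) -> 0 <= average W f.
Proof. by move=> f0; rewrite divr_ge0 ?ler0n ?sumr_ge0. Qed.

Definition bounded f : Prop := exists M, forall x, `|f x| <= M.

Lemma bounded_lin (a : R) f g :
  bounded f -> bounded g -> bounded (fun x => a * f x + g x).
Proof.
move=> [M fM] [N gN]; exists (`|a| * M + N) => x.
apply: le_trans (ler_normD _ _) _; rewrite lerD // normrM.
by rewrite ler_wpM2l.
Qed.

(* An ultrafilter limit of the averages along the Folner sets. *)
Lemma invariant_functional (gens : set S) : folner gens ->
  exists L : (S -> R) -> R, [/\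
    forall a f g, bounded f -> bounded g ->
      L (fun x => a * f x + g x) = a * L f + L g,
    forall f, bounded f -> (forall x, 0 <= f x) -> 0 <= L f,
    L (fun=> 1) = 1
    & forall s f, gens s -> bounded f ->
      L (fun x => f (s * x)%g) = L f /\ L (fun x => f (x * s)%g) = L f].
Proof.
move=> fol; pose I := (seq S * nat)%type.
have /choice[W WP] : forall i : I, exists W, (0 < size W)%N /\
    forall s f (M : R), s \in i.1 -> gens s -> (forall x, `|f x| <= M) ->
      `|average W (fun x => f (s * x)%g) - average W f| <= 2 * M / i.2.+1%:R /\
      `|average W (fun x => f (x * s)%g) - average W f| <= 2 * M / i.2.+1%:R.
  move=> [K N].
  have [|W [V [uW uV W0 [WV VN] KP]]] := fol [seq s <- K | `[< gens s >]] N.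
    by move=> s; rewrite mem_filter => /andP[/asboolP].
  exists W; split=> // s f M sK gs fM.
  have [|li ri tV] := KP s; first by rewrite mem_filter sK andbT; apply/asboolP.
  split; apply: (average_translate uW uV W0 WV VN) => //.
    by move=> x /tV[].
  by move=> x /tV[].
(* Indices are directed by inclusion of the finite sets and by [N]; the sets of later indices
   generate a proper filter. *)
pose B (i0 : I) : set I := [set i : I | {subset i0.1 <= i.1} /\ (i0.2 <= i.2)%N].
have FB : ProperFilter (filter_from setT B).
  apply: filter_from_proper; last by move=> i _; exists i; split.
  apply: filter_fromT_filter; first by exists ([::], 0%N).
  move=> i j; exists (i.1 ++ j.1, maxn i.2 j.2) => k [/= sk nk]; split; split.
  - by move=> x xi; apply: sk; rewrite mem_cat xi.
  - by apply: leq_trans nk; rewrite leq_maxl.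
  - by move=> x xj; apply: sk; rewrite mem_cat xj orbT.
  - by apply: leq_trans nk; rewrite leq_maxr.
have [U [UU FU]] := ultraFilterLemma FB.
have PU : ProperFilter U by exact: ultra_proper.
pose av f (i : I) : R := average (W i) f.
(* The averages stay in a compact segment, and a cluster point of an ultrafilter is its limit. *)
have avcvg f : bounded f -> cvg (av f @ U).
  move=> [M fM].
  have [|p [_ clp]] := @segment_compact R (- M) M (av f @ U) _.
    apply: (@filterS _ U _ setT); last exact: filterT.
    move=> i _ /=; rewrite in_itv /= -ler_norml.
    by apply: average_bound fM; have [] := WP i.
  apply/cvg_ex; exists p => A nA.
  have [//|UAc] := in_ultra_setVsetC (av f @^-1` A) UU.
  by have [x []] := clp (~` A) A UAc nA.
pose L f : R := lim (av f @ U).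
have LE f l : av f @ U --> l -> L f = l by move=> /cvg_lim; apply.
exists L; split.
- move=> a f g bf bg; apply: LE.
  rewrite (_ : av _ = fun i => a * av f i + av g i); last first.
    by apply/funext => i; rewrite /av averageD.
  apply: cvgD; last exact: avcvg.
  by apply: cvgMr; exact: avcvg.
- move=> f bf f0; apply: limr_ge; first exact: avcvg.
  by apply: nearW => i; exact: average_ge0.
- apply: LE; rewrite (_ : av _ = fun=> 1); first exact: cvg_cst.
  by apply/funext => i; rewrite /av average1 //; have [] := WP i.
- move=> s f gs bf; have [M fM] := bf.
  have key (tau : S -> S) : (forall i : I, s \in i.1 ->
      `|average (W i) (f \o tau) - average (W i) f| <= 2 * M / i.2.+1%:R) ->
      L (f \o tau) = L f.
    move=> tauP; have bft : bounded (f \o tau) by exists M => x; exact: fM.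
    have cd : (fun i => av (f \o tau) i - av f i) @ U --> L (f \o tau) - L f.
      by apply: cvgB; exact: avcvg.
    have M0 : 0 <= M by apply: le_trans (fM s).
    have nearN N : \forall i \near U,
        `|av (f \o tau) i - av f i| <= 2 * M / N.+1%:R.
      apply: FU; exists ([:: s], N) => // i [/= si Ni].
      have /tauP : s \in i.1 by apply: si; rewrite mem_head.
      move/le_trans; apply; rewrite ler_wpM2l ?mulr_ge0 //.
      by rewrite lef_pV2 ?posrE ?ltr0n // ler_nat.
    have bd N : `|L (f \o tau) - L f| <= 2 * M / N.+1%:R.
      have cdv : cvg ((fun i => av (f \o tau) i - av f i) @ U).
        by apply/cvg_ex; exists (L (f \o tau) - L f).
      rewrite ler_norml -(cvg_lim _ cd) //; apply/andP; split.
        apply: limr_ge => //; apply: filterS (nearN N) => i.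
        by rewrite ler_norml => /andP[].
      apply: limr_le => //; apply: filterS (nearN N) => i.
      by rewrite ler_norml => /andP[].
    apply/eqP; rewrite -subr_eq0 -normr_le0; apply/ler_addgt0Pl => e e0.
    rewrite addr0; pose N := Num.truncn (2 * M / e).
    apply: le_trans (bd N) _; rewrite ler_pdivrMr ?ltr0n // -ler_pdivrMl //.
    rewrite [leLHS]mulrC; exact: ltW (truncnS_gt _).
  split.
    by apply: (key (fun x => s * x)%g) => i si; have [] := (WP i).2 s f M si gs fM.
  by apply: (key (fun x => x * s)%g) => i si; have [] := (WP i).2 s f M si gs fM.
Qed.

End FolnerSets.

(** * From an invariant real functional to a complex mean *)

Section Means.
Variables (R : realType) (S : semigroupType).
Implicit Types (phi psi : Linfty R S).

Lemma abs_Re_le (z : R[i]) : `|complex.Re z| <= normc z.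
Proof.
by case: z => x y /=; rewrite -sqrtr_sqr ler_wsqrtr // lerDl sqr_ge0.
Qed.

Lemma abs_Im_le (z : R[i]) : `|complex.Im z| <= normc z.
Proof.
by case: z => x y /=; rewrite -sqrtr_sqr ler_wsqrtr // lerDr sqr_ge0.
Qed.

(** The real functional is applied to real and imaginary parts. Invariance under the generators
    spreads to products by the induction principle assumed for [gens]. *)
Lemma amenable_folner (gens : set S) : folner gens ->
  (forall Q : S -> Prop, (forall s, gens s -> Q s) ->
     (forall s t, Q s -> Q t -> Q (s * t)%g) -> forall s, Q s) ->
  amenable R S.
Proof.
move=> /(@invariant_functional R)[L [Llin Lpos L1 Linv]] gensP.
pose re phi s : R := complex.Re (phi s).
pose im phi s : R := complex.Im (phi s).
have bre phi : bounded (re phi).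
  by exists (supnorm phi) => s; apply: le_trans (abs_Re_le _) (normc_le_supnorm _ _).
have bim phi : bounded (im phi).
  by exists (supnorm phi) => s; apply: le_trans (abs_Im_le _) (normc_le_supnorm _ _).
have b1 (c : R) : bounded (fun _ : S => c) by exists `|c|.
have L0 : L (fun=> 0) = 0.
  have := Llin 1 _ _ (b1 0) (b1 0); under [in X in X = _]eq_fun do rewrite mulr0 addr0.
  rewrite mul1r => /eqP; by rewrite -subr_eq0 opprD addrA subrr sub0r oppr_eq0 => /eqP.
have LZ a f : bounded f -> L (fun x => a * f x) = a * L f.
  move=> bf; have := Llin a f _ bf (b1 0); rewrite L0 addr0 => <-.
  by congr L; apply/funext => x; rewrite addr0.
pose M phi : R[i]^o := Complex (L (re phi)) (L (im phi)).
have Mlin : linear M.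
  move=> a phi psi; apply/eqP; rewrite eq_complex; apply/andP.
  have reE : re (a *: phi + psi) = fun s => complex.Re a * re phi s +
      (- complex.Im a * im phi s + re psi s).
    apply/funext => s; rewrite /re /im.
    rewrite (_ : (a *: phi + psi) s = a * phi s + psi s) //.
    by case: (a) (phi s) (psi s) => a1 a2 [u v] [u' v'] /=; ring.
  have imE : im (a *: phi + psi) = fun s => complex.Re a * im phi s +
      (complex.Im a * re phi s + im psi s).
    apply/funext => s; rewrite /re /im.
    rewrite (_ : (a *: phi + psi) s = a * phi s + psi s) //.
    by case: (a) (phi s) (psi s) => a1 a2 [u v] [u' v'] /=; ring.
  rewrite /M reE imE !Llin ?LZ //; try exact: bounded_lin.
  by case: (a) => a1 a2; split; apply/eqP => /=; ring.
pose Ml : {linear Linfty R S -> R[i]^o} :=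
  HB.pack M (GRing.isLinear.Build _ _ _ _ M Mlin).
have Mnorm phi : normc (M phi) <= supnorm phi.
  set z := M phi; have [->|z0] := eqVneq z 0; first by rewrite normc0 supnorm_ge0.
  have nz : 0 < normc z.
    by rewrite lt0r normc_ge0 andbT; apply: contra_neq z0 => /eq0_normc.
  (* Multiplying by the conjugate of [z] makes [M psi = |z|^2] real; positivity of [L] on
     [|z| supnorm phi - Re psi] then gives the bound. *)
  pose psi : Linfty R S := z^*%C *: phi.
  have Lpsi : L (re psi) = normc z ^+ 2.
    have : M psi = z^*%C * z by exact: (linearZZ Ml).
    rewrite /M => /(congr1 (@complex.Re R)) /= ->.
    case: (z) => x y /=; rewrite sqr_sqrtr ?addr_ge0 ?sqr_ge0 //; ring.
  have le_psi s : re psi s <= normc z * supnorm phi.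
    apply: le_trans (ler_norm _) _; apply: le_trans (abs_Re_le _) _.
    rewrite (_ : psi s = z^*%C * phi s) // normcM.
    have -> : normc z^*%C = normc z by case: (z) => x y /=; rewrite sqrrN.
    by rewrite ler_wpM2l ?normc_ge0 ?normc_le_supnorm.
  have : 0 <= L (fun s => -1 * re psi s + normc z * supnorm phi).
    apply: Lpos; first exact: bounded_lin.
    by move=> s; rewrite mulN1r addrC subr_ge0.
  rewrite Llin // Lpsi.
  have -> : L (fun=> normc z * supnorm phi) = normc z * supnorm phi.
    by have := LZ (normc z * supnorm phi) _ (b1 1); rewrite L1 mulr1.
  by rewrite mulN1r addrC subr_ge0 expr2 ler_pM2l.
have M1 : M (Linfty1 R S) = 1.
  rewrite /M (_ : re _ = fun=> 1) // (_ : im _ = fun=> 0) // L1 L0.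
  by [].
have supn1 : supnorm (Linfty1 R S) <= 1.
  by apply: supnorm_le => // s; rewrite normc1.
exists Ml; [split|].
- apply: bounded_linear_continuous; apply/linear_boundedP.
  near=> r => phi.
  have r1 : 1 <= r by near: r; apply: nbhs_pinfty_ge; exact: real1.
  apply: (@le_trans _ _ `|phi|); last by rewrite ler_peMl.
  by rewrite -[`|Ml phi|]/((normc (M phi))%:C)%C -[`|phi|]/((supnorm phi)%:C)%C lecR.
- move=> phi phi0; rewrite -[Ml phi]/(M phi) /M.
  have -> : im phi = fun=> 0.
    apply/funext => s; have := phi0 s; rewrite /im.
    by case: (phi s) => x y; rewrite lecE /= => /andP[/eqP].
  rewrite L0 lecE /= eqxx /=; apply: Lpos => // s.
  by have := phi0 s; rewrite lecE /re => /andP[].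
- rewrite /opnorm; apply/eqP; rewrite eq_le; apply/andP; split.
    apply: ge_sup.
      exists (normc (M (Linfty1 R S))), (Linfty1 R S) => //=.
      by rewrite -[`|_|]/((supnorm (Linfty1 R S))%:C)%C -[1]/((1 : R)%:C)%C lecR.
    move=> _ [phi /= phi1 <-]; apply: le_trans (Mnorm phi) _.
    by move: phi1; rewrite -[`|_|]/((supnorm phi)%:C)%C -[1]/((1 : R)%:C)%C lecR.
  apply: ub_le_sup.
    exists 1 => _ [phi /= phi1 <-]; apply: le_trans (Mnorm phi) _.
    by move: phi1; rewrite -[`|_|]/((supnorm phi)%:C)%C -[1]/((1 : R)%:C)%C lecR.
  exists (Linfty1 R S); last by rewrite -[Ml _]/(M (Linfty1 R S)) M1 normc1.
  by rewrite /= -[`|_|]/((supnorm (Linfty1 R S))%:C)%C -[1]/((1 : R)%:C)%C lecR.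
- exact: M1.
- move=> s phi; rewrite -[Ml (rtrans s phi)]/(M (rtrans s phi)).
  rewrite -[Ml (ltrans s phi)]/(M (ltrans s phi)) -[Ml phi]/(M phi).
  pose Q s := forall phi, M (rtrans s phi) = M phi /\ M (ltrans s phi) = M phi.
  move: s phi; apply: (gensP Q).
    move=> s gs phi; rewrite /M.
    have [l1 r1] := Linv s _ gs (bre phi); have [l2 r2] := Linv s _ gs (bim phi).
    by split; congr Complex; [exact: r1 | exact: r2 | exact: l1 | exact: l2].
  move=> s t Qs Qt phi; split.
    rewrite -(Qt phi).1 -(Qs (rtrans t phi)).1; congr M.
    by apply: val_inj; apply/funext => x; rewrite /= mulgA.
  rewrite -(Qs phi).2 -(Qt (ltrans s phi)).2; congr M.
  by apply: val_inj; apply/funext => x; rewrite /= mulgA.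
Unshelve. all: by end_near. Qed.

End Means.

(** * Folner sets in the generated semigroup *)

Section GeneratedSemigroupFolner.
Variables (R : realType) (F : set (sphere R -> sphere R)).
Local Notation S := (sphere R).
Local Notation G := (gen_semigroup F).

Lemma gen_semigroup_ind (Q : G -> Prop) :
  (forall s : G, F (val s) -> Q s) ->
  (forall s t : G, Q s -> Q t -> Q (s * t)%g) -> forall s, Q s.
Proof.
move=> Qg Qm [f fS].
have cf : composition_of F f := set_mem fS.
elim: cf fS => {f} [f Ff|f g cf Qf cg Qg'] fS; first exact: Qg.
have fS' := mem_set (cf : [set f | composition_of F f]%classic f).
have gS' := mem_set (cg : [set f | composition_of F f]%classic g).
rewrite (_ : exist _ _ _ = (exist _ f fS' : G) * (exist _ g gS' : G))%g.
  exact: Qm.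
exact: val_inj.
Qed.

Lemma composition_of_word (w : seq (S -> S)) :
  (forall P, P \in w -> F P) -> (0 < size w)%N ->
  composition_of F (compose_word w).
Proof.
elim: w => // P [|P' w] IH wF _.
  by rewrite /= (_ : P \o idfun = P) //; apply/composition_gen/wF/mem_head.
apply: composition_comp; first by apply/composition_gen/wF/mem_head.
by apply: IH => // Q Qw; apply: wF; rewrite inE Qw orbT.
Qed.

(** The sets are balls of maps given by nonempty words of bounded length: translation by a letter
    lengthens a word by one, so [V] is the next ball. *)
Lemma gen_semigroup_folner :
  (forall f, F f -> rational_map f) ->
  (exists2 f, F f & ~ has_degree f 1) ->
  (forall P Q, F P -> F Q -> exists m n : nat,
     (1 <= m)%N /\ (1 <= n)%N /\ iter m P = iter n Q) ->
  folner [set s : G | F (val s)]%classic.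
Proof.
move=> Frat [f0 Ff0 f0deg] Fit K N KF.
(* Adding [f0] makes the balls nonempty even if [K] is empty; the common iterate is an iterate of
   [f0]. *)
pose Ks : seq (S -> S) := f0 :: [seq val s | s : G <- K].
have KsF P : P \in Ks -> F P.
  by rewrite inE => /orP[/eqP->//|/mapP[s sK ->]]; exact: KF.
have [n nP] := common_iterate_seq (fun P FP => Fit P f0 FP Ff0) KsF.
set h := iter n.+1 f0 in nP.
have gf0 : ratsurj f0 by exact/rational_map_ratsurj/Frat.
have gh : ratsurj h by exact: ratsurj_iter.
have [p fp] := rational_fixed_point (Frat _ Ff0).
have hp : h p = p by exact: iter_fix.
have hid r : (0 < r)%N -> iter r h <> id.
  (* If an iterate of [h] were the identity, [f0] would have a left inverse, which degree at least 2
     excludes. *)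
  case: r => // r _ hr; have [d d0 fd] := Frat _ Ff0.
  have d1 : (1 < d)%N.
    by case: d d0 fd => // -[|d] // _ /f0deg.
  apply: (degree_gt1_not_injective d1 fd) => x y fxy.
  have hE z : z = iter ((r.+1 * n.+1).-1)%N f0 (f0 z).
    by rewrite -iterSr prednK ?muln_gt0 // iterM -/h hr.
  by rewrite (hE x) (hE y) fxy.
have KsP P : P \in Ks -> ratsurj P /\ exists m, iter m.+1 P = h.
  by move=> PK; split; [exact/rational_map_ratsurj/Frat/KsF | exact: nP].
have [c [e ce]] := poly_growth_words gh hp hid KsP.
pose W k := undup [seq compose_word w | w <- words Ks k].
have WP k A : A \in W k -> exists w,
    [/\ all (mem Ks) w, (0 < size w)%N, (size w <= k)%N & A = compose_word w].
  rewrite mem_undup => /mapP[w]; rewrite mem_words => /and3P[wK w0 wk] ->.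
  by exists w.
have PW k w : all (mem Ks) w -> (0 < size w)%N -> (size w <= k)%N ->
    compose_word w \in W k.
  by move=> wK w0 wk; rewrite mem_undup map_f // mem_words wK w0 wk.
have Wcomp k A : A \in W k -> A \in [set f | composition_of F f]%classic.
  move=> /WP[w [wK w0 _ ->]]; apply/mem_set/composition_of_word => // P Pw.
  by apply: KsF; move/allP: wK; apply.
have W0 k : (0 < size (W k.+1))%N.
  have : compose_word [:: f0] \in W k.+1 by apply: PW => //=; rewrite mem_head.
  by case: (W _).
have Wgrowth k : (size (W k) <= c * k.+1 ^ e)%N.
  apply: ce; first exact: undup_uniq.
  by move=> A /WP[w [wK _ wk ->]]; exists w.
have [k kN] := growth_ratio N W0 Wgrowth.
pose Wg j : seq G := pmap insub (W j).
have memWg j (x : G) : (x \in Wg j) = (val x \in W j) by exact: mem_pmap_sub.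
have sizeWg j : size (Wg j) = size (W j).
  rewrite size_pmap_sub; apply/eqP; rewrite -all_count; apply/allP => A.
  exact: Wcomp.
have comm A j : A \in W j -> A \o h = h \o A.
  by move=> /WP[w [wK _ _ ->]]; exact: (word_commute KsP wK).
exists (Wg k.+1), (Wg k.+2); rewrite !sizeWg; split.
- exact/pmap_sub_uniq/undup_uniq.
- exact/pmap_sub_uniq/undup_uniq.
- exact: W0.
- split=> // x; rewrite !memWg => /WP[w [wK w0 wk ->]].
  by apply: PW => //; exact: leqW.
move=> s sK.
have sKs : val s \in Ks by rewrite inE map_f ?orbT.
have [[_ ssurj] [m sm]] := KsP _ sKs.
split.
(* From [s x = s y] follows [h x = h y], as [h] is an iterate of [s]; then [x h = y h], and [h] is
   onto. *)
- move=> x y; rewrite !memWg => /comm xh /comm yh /(congr1 val) /= sxy.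
  apply: val_inj; apply/funext => z.
  have hx : h \o val x = h \o val y.
    apply/funext => t; rewrite -sm /= -!iterS !iterSr; congr (iter m _ _).
    exact: (congr1 (@^~ t) sxy).
  have [t <-] := (proj2 gh) z.
  have := congr1 (@^~ t) xh; have := congr1 (@^~ t) yh; rewrite /= => -> ->.
  exact: (congr1 (@^~ t) hx).
- move=> x y _ _ /(congr1 val) /= sxy.
  apply: val_inj; apply/funext => z; have [t <-] := ssurj z.
  exact: (congr1 (@^~ t) sxy).
- move=> x; rewrite !memWg => /WP[w [wK w0 wk xw]]; split.
    rewrite (_ : val _ = compose_word (val s :: w)); last by rewrite /= -xw.
    by apply: PW => //=; rewrite sKs wK.
  rewrite (_ : val _ = compose_word (rcons w (val s))); last first.
    by rewrite compose_word_rcons -xw.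
  by apply: PW; rewrite ?size_rcons // all_rcons /= sKs.
Qed.

End GeneratedSemigroupFolner.

Theorem theorem31 (R : realType) (F : set (sphere R -> sphere R))
  (F_rational : forall f, F f -> rational_map f)
  (F_nonexceptional : nonexceptional_family F)
  (F_common_iterate : forall P Q, F P -> F Q ->
     exists m n : nat,
       (1 <= m)%N /\ (1 <= n)%N /\ iter m P = iter n Q) :
  amenable R (gen_semigroup F).
Proof.
apply: (@amenable_folner _ _ [set s : gen_semigroup F | F (val s)]%classic).
  apply: gen_semigroup_folner => //; have [f Ff fex] := F_nonexceptional.
  (* Degree 1 is the first clause of [exceptional]. *)
  by exists f => // f1; apply: fex; left.
exact: gen_semigroup_ind.
Qed.
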